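(* Let $k,\hat n,\tilde n\ge1$ be integers with $\tilde n\le\hat n$, let $n=\hat n\cdot\tilde n$, and let $B\in\mathbb{R}^{n\times n}$ be symmetric positive semi-definite and nonzero. Put $\rho=\operatorname{trace}(B)/\|B\|_2$. For random vectors $\tilde x_1,\ldots,\tilde x_k$ with values in $\mathbb{R}^{\tilde n}$ and $\hat x_1,\ldots,\hat x_k$ with values in $\mathbb{R}^{\hat n}$, let $$\mathsf{Est}_k=\frac1k\sum_{i=1}^k(\tilde x_i\otimes\hat x_i)^TB(\tilde x_i\otimes\hat x_i),$$ and consider the bound $$\operatorname{trace}(B)\ge\frac{1}{1+\varepsilon}\,\mathsf{Est}_k.\qquad( * )$$ (i) If $\tilde x_1,\ldots,\tilde x_k,\hat x_1,\ldots,\hat x_k$ are independent standard Gaussian random vectors and $0<\varepsilon<\frac{25}{16}$, then $( * )$ holds with probability at least $$1-\exp\Big(-\frac{k\rho\varepsilon^2}{50\,\hat n}\Big)-k\,\frac{1}{5^{\hat n/2}}.$$ (ii) If $\tilde x_1,\ldots,\tilde x_k,\hat x_1,\ldots,\hat x_k$ are independent Rademacher random vectors and $0<\varepsilon<\frac{13}{4}$, then $( * )$ holds with probability at least $$1-\exp\Big(-\frac{k\rho\varepsilon^2}{52\,\hat n}\Big).$$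
   Context: $\otimes$ denotes the Kronecker product and $\|\cdot\|_2$ is the spectral norm of a matrix. A standard Gaussian vector of length $d$ has distribution $\mathcal{N}(0,I_d)$. A Rademacher vector is a random vector whose entries are independent and take the values $1$ and $-1$, each with probability $1/2$. The quantity $\rho$ is the stable rank of any matrix $A$ with $B=A^TA$. *)

(* Defs.v *)
From HB Require Import structures.
From mathcomp Require Import all_boot all_order all_algebra.
From mathcomp Require Export mxtens.
From mathcomp Require Import all_classical all_reals all_analysis.

Set Implicit Arguments.
Unset Strict Implicit.
Unset Printing Implicit Defensive.

Import Order.TTheory GRing.Theory Num.Theory.
Import numFieldNormedType.Exports.

Local Open Scope classical_set_scope.
Local Open Scope ring_scope.

Section matrices.
Context {R : realType}.

Definition norm2 n (x : 'cV[R]_n) : R := Num.sqrt (\sum_i x i 0 ^+ 2).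

(* The norm [`|A|] that the library puts on matrices is the largest absolute
   value of an entry, hence this separate operator norm. *)
Definition spectral_norm m n (A : 'M[R]_(m, n)) : R :=
  sup [set norm2 (A *m x) | x in [set x : 'cV[R]_n | norm2 x <= 1]].

Definition qform n (B : 'M[R]_n) (x : 'cV[R]_n) : R := (x^T *m B *m x) 0 0.

Definition psd n (B : 'M[R]_n) : Prop :=
  B^T = B /\ forall x : 'cV[R]_n, 0 <= qform B x.

(* Random vectors are tuple-valued, because the library has the product
   sigma-algebra on tuples but not on matrices. *)
Definition colv n (x : n.-tuple R) : 'cV[R]_n := \col_i tnth x i.

End matrices.

Section random_vectors.
Context {d : measure_display} {T : measurableType d} {R : realType}.
Variable P : probability T R.

Definition independent_classes (I : finType) (F : I -> set_system T) : Prop :=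
  forall (J : {set I}) (A : I -> set T), (forall i, i \in J -> F i (A i)) ->
  P (\bigcap_(i in [set` J]) A i) = (\prod_(i in J) P (A i))%E.

Definition sigma_of d' (T' : measurableType d') (X : T -> T') : set_system T :=
  preimage_set_system setT X measurable.

Definition independent_entries n (X : T -> n.-tuple R) : Prop :=
  independent_classes (fun i => sigma_of (fun t => tnth (X t) i)).

Definition std_gaussian n (X : {RV P >-> n.-tuple R}) : Prop :=
  independent_entries X /\
  forall (i : 'I_n) (A : set R), measurable A ->
    P [set t | A (tnth (X t) i)] = normal_prob 0 1 A.

Definition rademacher n (X : {RV P >-> n.-tuple R}) : Prop :=
  independent_entries X /\
  forall i : 'I_n, P [set t | tnth (X t) i = 1] = (2^-1)%:E /\
                   P [set t | tnth (X t) i = -1] = (2^-1)%:E.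

(* x_1, ..., x_k, y_1, ..., y_k is a single family of 2k vectors, of two
   different dimensions; the disjoint sum indexes it. *)
Definition independent_vectors k m n (x : 'I_k -> {RV P >-> m.-tuple R})
    (y : 'I_k -> {RV P >-> n.-tuple R}) : Prop :=
  independent_classes (fun i : 'I_k + 'I_k =>
    match i with inl a => sigma_of (x a) | inr b => sigma_of (y b) end).

Definition Est k m n (B : 'M[R]_(m * n)) (x : 'I_k -> {RV P >-> m.-tuple R})
    (y : 'I_k -> {RV P >-> n.-tuple R}) (t : T) : R :=
  k%:R^-1 * \sum_(i < k) qform B (colv (x i t) *t colv (y i t)).

End random_vectors.

(* Main.v *)
Require Import Defs.
From HB Require Import structures.
From mathcomp Require Import all_boot all_order all_algebra.
From mathcomp Require Import complex ring lra.
From mathcomp Require Import all_classical all_reals all_analysis.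
From mathcomp Require Import measurable_realfun.

(** The proof is Chernoff's method with two successive conditionings.  Write
    [q = qform B (x *t y)] for a pair [x = tx i], [y = hx i].

    For fixed [y], [q] is a quadratic form in [x] with matrix [slice B y].  This
    form is at most [|B| |y|^2 |x|^2], where [|B|] is the spectral norm, and its
    trace is again a quadratic form in [y], whose matrix [partial_trace B] has
    trace [\tr B] and is bounded by [tn |B| <= hn |B|].  So a bound on the
    moment generating function of a quadratic form in one random vector can be
    used twice, first over [x] given [y] and then over [y].

    That bound is [qform_mgf_trace]: if [0 <= C <= l] as quadratic forms and
    [2 l < 1], then [E exp (qform C) <= exp (inflation l * \tr C)], with
    [inflation l = (1 - l) / (1 - 2 l)].  It holds for independent entries whose
    law is [gaussian_dominated], a property shared by the Gaussian and the
    Rademacher laws.  Integrating one coordinate at a time, each step taking a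
    Schur complement, gives [E exp (qform C) <= det (1 - 2 C)^(-1/2)]
    ([qform_mgf_det]); the determinant and the trace are then compared
    eigenvalue by eigenvalue ([det_ge_expR_trace]).

    The first use of the bound needs [|y|^2 <= c hn].  A Rademacher vector
    satisfies this with [c = 1].  A Gaussian vector satisfies it with [c = 4]
    except on an event of probability at most [5^(- hn / 2)]; a union bound over
    the [k] vectors produces the extra term of the Gaussian statement.  On the
    complement, the moment generating function of the estimator factors over
    the [k] independent pairs ([mgf_est]), and [est_tail] is the resulting
    Chernoff bound.  Its exponent is evaluated at [theta hn |B| = eps / r], with
    [r = 25] for Gaussian and [r = 26] for Rademacher vectors; the upper bounds
    on [eps] in the theorem keep this number at most [1 / 16] and [1 / 8]. *)

Set Implicit Arguments.
Unset Strict Implicit.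
Unset Printing Implicit Defensive.

Import Order.TTheory GRing.Theory Num.Theory.
Import numFieldNormedType.Exports.

Local Open Scope classical_set_scope.
Local Open Scope ring_scope.

(** * Quadratic forms *)

Lemma qformE {R : realType} n (B : 'M[R]_n) (x : 'cV[R]_n) :
  qform B x = \sum_i \sum_j x i 0 * B i j * x j 0.
Proof.
rewrite /qform -mulmxA mxE; apply: eq_bigr => i _.
by rewrite !mxE mulr_sumr; apply: eq_bigr => j _; rewrite mulrA.
Qed.

Lemma qform1 {R : realType} n (x : 'cV[R]_n) :
  qform 1%:M x = \sum_i x i 0 ^+ 2.
Proof.
by rewrite /qform mulmx1 mxE; apply: eq_bigr => i _; rewrite mxE expr2.
Qed.

Lemma qform1_ge0 {R : realType} n (x : 'cV[R]_n) : 0 <= qform 1%:M x.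
Proof. by rewrite qform1 sumr_ge0// => i _; exact: sqr_ge0. Qed.

Lemma qform1_gt0 {R : realType} n (x : 'cV[R]_n) : x != 0 -> 0 < qform 1%:M x.
Proof.
move=> x0; rewrite lt_neqAle qform1_ge0 andbT; apply: contra x0.
rewrite qform1 eq_sym psumr_eq0; last by move=> *; exact: sqr_ge0.
move=> /allP xi0; apply/eqP/colP => i.
by have := xi0 i (mem_index_enum i); rewrite sqrf_eq0 => /eqP ->; rewrite mxE.
Qed.

Lemma qformD {R : realType} n (A B : 'M[R]_n) x :
  qform (A + B) x = qform A x + qform B x.
Proof. by rewrite /qform mulmxDr mulmxDl mxE. Qed.

Lemma qformZ {R : realType} n a (A : 'M[R]_n) x :
  qform (a *: A) x = a * qform A x.
Proof. by rewrite /qform -scalemxAr -scalemxAl mxE. Qed.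

Lemma qform_mul {R : realType} m n (B : 'M[R]_m) (K : 'M[R]_(m, n)) x :
  qform B (K *m x) = qform (K^T *m B *m K) x.
Proof. by rewrite /qform trmx_mul !mulmxA. Qed.

Lemma qform0 {R : realType} n (B : 'M[R]_n) : qform B 0 = 0.
Proof. by rewrite /qform mulmx0 mxE. Qed.

Lemma psdZ {R : realType} n a (C : 'M[R]_n) : 0 <= a -> psd C -> psd (a *: C).
Proof.
move=> a0 [CT C0]; split; first by rewrite linearZ /= CT.
by move=> x; rewrite qformZ mulr_ge0.
Qed.

(** * The spectrum of a positive semi-definite matrix *)

Section eigenvalues.
Context {R : realType} {n : nat}.
Variables (C : 'M[R]_n) (l : R).
Hypothesis Cpsd : psd C.
Hypothesis Cl : forall x, qform C x <= l * qform 1%:M x.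

(** Write a complex row eigenvector as [a + i b] and the eigenvalue as
    [z = p + i q].  Symmetry of [C] gives [q (|a|^2 + |b|^2) = 0], hence
    [q = 0]; then [p (|a|^2 + |b|^2)] is the sum of the values of the quadratic
    form at [a] and [b], which the hypotheses bound on both sides. *)
Lemma psd_complex_eigenvalue (z : R[i]) :
  root (char_poly (map_mx (real_complex R) C)) z ->
  complex.Im z = 0 /\ 0 <= complex.Re z <= l.
Proof.
rewrite -eigenvalue_root_char => /eigenvalueP[v vC v0].
have ReD : {morph @complex.Re R : x y / x + y} by case=> ? ? [? ?].
have ImD : {morph @complex.Im R : x y / x + y} by case=> ? ? [? ?].
pose a := map_mx (@complex.Re R) v; pose b := map_mx (@complex.Im R) v.
have aC : a *m C = complex.Re z *: a - complex.Im z *: b.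
  apply/rowP => j; have /matrixP/(_ 0 j)/(congr1 (@complex.Re R)) := vC.
  rewrite !mxE (big_morph (@complex.Re R) ReD (erefl _)).
  case: z (v 0 j) {vC} => p q [c d] /= => <-; apply: eq_bigr => i _.
  by rewrite !mxE; case: (v 0 i) => ? ? /=; rewrite mulr0 subr0.
have bC : b *m C = complex.Re z *: b + complex.Im z *: a.
  apply/rowP => j; have /matrixP/(_ 0 j)/(congr1 (@complex.Im R)) := vC.
  rewrite !mxE (big_morph (@complex.Im R) ImD (erefl _)).
  case: z (v 0 j) {vC aC} => p q [c d] /= => <-; apply: eq_bigr => i _.
  by rewrite !mxE; case: (v 0 i) => ? ? /=; rewrite mulr0 add0r.
pose N (u w : 'rV[R]_n) := (u *m w^T) 0 0.
have NC u w : N u w = N w u.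
  by rewrite /N !mxE; apply: eq_bigr => i _; rewrite !mxE mulrC.
have qN u : qform C u^T = N (u *m C) u by rewrite /qform trmxK.
have q1N u : qform 1%:M u^T = N u u by rewrite /qform trmxK mulmx1.
have NDl u u' w : N (u + u') w = N u w + N u' w by rewrite /N mulmxDl mxE.
have NZl c u w : N (c *: u) w = c * N u w by rewrite /N -scalemxAl mxE.
have NNl u w : N (- u) w = - N u w by rewrite /N mulNmx mxE.
have Cab : N (a *m C) b = N (b *m C) a.
  by rewrite NC /N trmx_mul (proj1 Cpsd) mulmxA.
have ab0 : 0 < N a a + N b b.
  rewrite -!q1N.
  have [a0|a0] := eqVneq a 0; last first.
    by rewrite ltr_pwDl ?qform1_ge0// qform1_gt0// trmx_eq0.
  rewrite ltr_wpDl ?qform1_ge0// qform1_gt0// trmx_eq0.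
  apply: contra v0 => /eqP b0; apply/eqP/rowP => j.
  have /matrixP/(_ 0 j) := a0; have /matrixP/(_ 0 j) := b0.
  by rewrite !mxE; case: (v 0 j) => ? ? /= -> ->.
have Im0 : complex.Im z = 0.
  move: Cab; rewrite aC bC !NDl NNl !NZl (NC b a) => /eqP.
  rewrite -subr_eq0 => E.
  have {E} : complex.Im z * (N a a + N b b) == 0.
    by rewrite -oppr_eq0; apply: etrans E; congr (_ == 0); ring.
  by rewrite mulf_eq0 (gt_eqF ab0) orbF => /eqP.
split => //.
have Cz : qform C a^T + qform C b^T = complex.Re z * (N a a + N b b).
  by rewrite !qN aC bC Im0 !scale0r subr0 addr0 !NZl mulrDr.
apply/andP; split.
  by rewrite -(pmulr_lge0 _ ab0) -Cz addr_ge0//; exact: (proj2 Cpsd).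
rewrite -(ler_pM2r ab0) -Cz mulrDr -!q1N.
by rewrite lerD.
Qed.

(** The characteristic polynomial splits over the complex numbers, where
    its roots are real by the previous lemma. *)
Lemma psd_char_poly : exists2 s : seq R,
  char_poly C = \prod_(a <- s) ('X - a%:P) & forall a, a \in s -> 0 <= a <= l.
Proof.
have [r rE] := closed_field_poly_normal (char_poly (map_mx (real_complex R) C)).
have {}rE : char_poly (map_mx (real_complex R) C) = \prod_(z <- r) ('X - z%:P).
  by rewrite rE (monicP (char_poly_monic _)) scale1r.
have rP z : z \in r -> complex.Im z = 0 /\ 0 <= complex.Re z <= l.
  by move=> zr; apply: psd_complex_eigenvalue; rewrite rE root_prod_XsubC.
exists (map (@complex.Re R) r) => [|_ /mapP[z /rP[_ ?] ->]//].
apply: (map_poly_inj (real_complex R)).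
rewrite map_char_poly rE big_map rmorph_prod /=.
apply: eq_big_seq => z /rP[z0 _].
rewrite rmorphB /= map_polyX map_polyC /=; congr ('X - _%:P).
by case: z z0 => ? ? /= ->.
Qed.

Lemma psd_spectrum : exists s : seq R,
  [/\ forall a, a \in s -> 0 <= a <= l, \tr C = \sum_(a <- s) a
    & \det (1%:M - 2 *: C) = \prod_(a <- s) (1 - 2 * a)].
Proof.
have [s sE sl] := psd_char_poly; exists s; split => //.
  have [n0|n0] := posnP n.
    have -> : s = [::].
      apply: size0nil; apply/eqP; rewrite -eqSS -(size_prod_XsubC _ id) -sE.
      by rewrite size_char_poly n0.
    by rewrite big_nil /mxtrace big1// => -[i i_n]; exfalso; rewrite n0 in i_n.
  have sn : size s = n.
    by apply/eqP; rewrite -eqSS -(size_prod_XsubC _ id) -sE size_char_poly.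
  have := char_poly_trace C n0; rewrite sE -[in _.-1]sn coefPn_prod_XsubC.
    by move/eqP; rewrite eqr_opp => /eqP.
  by rewrite sn -lt0n.
have sn : size s = n.
  by apply/eqP; rewrite -eqSS -(size_prod_XsubC _ id) -sE size_char_poly.
have -> : 1%:M - 2 *: C = 2 *: (2^-1%:M - C).
  by rewrite scalerBr scale_scalar_mx mulfV.
rewrite detZ.
have -> : \det (2^-1%:M - C) = (char_poly C).[2^-1].
  rewrite -horner_evalE /char_poly -det_map_mx; congr (\det _).
  apply/matrixP => i j; rewrite !mxE /= /horner_eval !hornerE.
  by rewrite hornerMn hornerX.
rewrite sE horner_prod -[X in 2 ^+ X]sn.
elim: (s) => [|a t IH]; first by rewrite !big_nil mulr1.
by rewrite !big_cons -IH exprS !hornerE/=; field.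
Qed.

(** Each eigenvalue [a] contributes [1 - 2 a] to the determinant and [a] to the
    trace, so that an inequality between the two for every number in [[0, l]]
    passes to the determinant and the trace. *)
Lemma det_ge_expR_trace k :
  (forall a, 0 <= a <= l -> expR (- (2 * k * a)) <= 1 - 2 * a) ->
  expR (- (2 * k * \tr C)) <= \det (1%:M - 2 *: C).
Proof.
have [s [sl -> ->]] := psd_spectrum; move=> kP.
rewrite mulr_sumr -sumrN expR_sum big_seq [leRHS]big_seq.
by apply: ler_prod => a /sl al; rewrite expR_ge0 kP.
Qed.

End eigenvalues.

(** * Eliminating one coordinate from a quadratic form *)

(** For a standard Gaussian variable [X],
    [E exp (c X^2 + 2 w X) = (1 - 2 c)^(-1/2) exp (2 w^2 / (1 - 2 c))].  Hence
    integrating [exp (qform C)] over the first coordinate, with [w] the scalar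
    product of [b] and the other coordinates, produces [exp (qform schur_C)].
    The matrix [1 - 2 schur_C] is the Schur complement of the corner [1 - 2 c]
    in [1 - 2 C], which accounts for the determinant in the final bound. *)
Section schur.
Context {R : realType} {n : nat}.
Variable C : 'M[R]_(1 + n).
Hypothesis Cpsd : psd C.
Hypothesis Cpd :
  forall x : 'cV[R]_(1 + n), x != 0 -> 0 < qform (1%:M - 2 *: C) x.

Definition schur_c : R := ulsubmx C 0 0.
Definition schur_b : 'cV[R]_n := dlsubmx C.
Definition schur_C : 'M[R]_n :=
  drsubmx C + (2 / (1 - 2 * schur_c)) *: (schur_b *m schur_b^T).

Local Notation c := schur_c.
Local Notation b := schur_b.
Local Notation C'' := schur_C.

Let dot (y : 'cV[R]_n) := (b^T *m y) 0 0.

Lemma schur_ur : ursubmx C = b^T.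
Proof. by rewrite /b trmx_dlsub (proj1 Cpsd). Qed.

Lemma schur_block : C = block_mx c%:M b^T b (drsubmx C).
Proof. by rewrite -[LHS]submxK schur_ur [ulsubmx C]mx11_scalar. Qed.

Lemma qform_block x (y : 'cV[R]_n) :
  qform C (col_mx x%:M y) =
    c * x ^+ 2 + 2 * dot y * x + qform (drsubmx C) y.
Proof.
rewrite /qform [in LHS]schur_block tr_col_mx mul_row_block mul_row_col.
have -> : y^T *m b = (b^T *m y)^T by rewrite trmx_mul trmxK.
rewrite tr_scalar_mx !mulmxDl -!scalar_mxM !mul_scalar_mx -!scalemxAl.
rewrite /dot !mul_mx_scalar mxE mxE !mxE /=; ring.
Qed.

Lemma schur_c_ge0 : 0 <= c.
Proof.
have := proj2 Cpsd (col_mx 1%:M 0); rewrite qform_block qform0.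
by rewrite /dot mulmx0 mxE mulr0 mul0r !addr0 expr1n mulr1.
Qed.

Lemma qform1_col x (y : 'cV[R]_n) :
  qform 1%:M (col_mx x%:M y) = x ^+ 2 + qform 1%:M y.
Proof.
rewrite !qform1 big_split_ord /= big_ord1 col_mxEu mxE eqxx mulr1n.
by congr (_ + _); apply: eq_bigr => i _; rewrite col_mxEd.
Qed.

Lemma schur_c_lt : 2 * c < 1.
Proof.
have /Cpd : col_mx 1%:M 0 != 0 :> 'cV[R]_(1 + n).
  apply/eqP => /(congr1 usubmx); rewrite col_mxKu => /matrixP/(_ 0 0)/eqP.
  by rewrite !mxE oner_eq0.
rewrite qformD -scaleNr qformZ qform_block qform1_col !qform0.
rewrite /dot mulmx0 mxE mulr0 mul0r !addr0 expr1n mulr1 mulNr.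
by rewrite subr_gt0.
Qed.

Lemma qform_schur y :
  qform C'' y = qform (drsubmx C) y + 2 * dot y ^+ 2 / (1 - 2 * c).
Proof.
rewrite qformD qformZ /dot; congr (_ + _).
rewrite [qform (b *m _) _]/qform mulmxA -mulmxA mxE big_ord1.
rewrite -[y^T *m b]trmxK trmx_mul trmxK mxE; ring.
Qed.

Lemma schur_psd : psd C''.
Proof.
split.
  rewrite /C'' linearD /= linearZ /= trmx_mul trmxK trmx_drsub.
  by rewrite (proj1 Cpsd).
move=> y; rewrite qform_schur addr_ge0//.
  have := proj2 Cpsd (col_mx 0%:M y); rewrite qform_block.
  by rewrite expr0n/= !mulr0 !add0r.
apply: divr_ge0; first by rewrite mulr_ge0 ?sqr_ge0.
by rewrite subr_ge0 ltW// schur_c_lt.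
Qed.

(** [qform (1 - 2 C'')] is the minimum of [qform (1 - 2 C)] over the first
    coordinate. *)
Lemma schur_pd y : y != 0 -> 0 < qform (1%:M - 2 *: C'') y.
Proof.
move=> y0; pose x := 2 * dot y / (1 - 2 * c).
have /Cpd : col_mx x%:M y != 0.
  apply: contra y0 => /eqP/(congr1 dsubmx); rewrite col_mxKd => ->.
  by apply/eqP/matrixP => i j; rewrite !mxE.
have d0 : 1 - 2 * c != 0 by rewrite subr_eq0 gt_eqF// schur_c_lt.
rewrite !qformD -!scaleNr !qformZ qform_block qform1_col qform_schur /x.
by set u := qform _ _; set v := qform _ _; set w := dot y;
  congr (0 < _); field.
Qed.

Lemma det_schur :
  \det (1%:M - 2 *: C) = (1 - 2 * c) * \det (1%:M - 2 *: C'').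
Proof.
have d0 : 1 - 2 * c != 0 by rewrite subr_eq0 gt_eqF// schur_c_lt.
(* block LU factorization *)
have -> : 1%:M - 2 *: C =
  block_mx 1%:M 0 (- (2 / (1 - 2 * c)) *: b) 1%:M *m
  block_mx (1 - 2 * c)%:M (- 2 *: b^T) 0 (1%:M - 2 *: C'').
  rewrite [in LHS]schur_block scale_block_mx opp_block_mx scalar_mx_block.
  rewrite add_block_mx mulmx_block !mul1mx !mul0mx !addr0.
  rewrite ?add0r scaleNr mul_mx_scalar.
  congr block_mx.
  - by apply/matrixP => i j; rewrite !mxE (ord1 i) (ord1 j) !eqxx !mulr1n.
  - by rewrite scalerA -scaleNr; congr (_ *: _); field.
  - rewrite scaleNr mulNmx mulmxN opprK -scalemxAl -scalemxAr scalerA /C''.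
    by move: (b *m b^T) => X; apply/matrixP => i j; rewrite !mxE; ring.
by rewrite det_mulmx det_lblock det_ublock !det1 !mul1r det_scalar1.
Qed.

End schur.

(** * The spectral norm bounds the quadratic form *)

Section spectral_norm.
Context {R : realType} {n : nat}.
Variable B : 'M[R]_n.

Lemma norm2_sqr m (x : 'cV[R]_m) : norm2 x ^+ 2 = qform 1%:M x.
Proof.
by rewrite /norm2 sqr_sqrtr ?qform1// sumr_ge0// => i _; exact: sqr_ge0.
Qed.

Lemma norm2_ge0 m (x : 'cV[R]_m) : 0 <= norm2 x.
Proof. exact: sqrtr_ge0. Qed.

Lemma norm2Z m c (x : 'cV[R]_m) : norm2 (c *: x) = `|c| * norm2 x.
Proof.
apply/eqP; rewrite -(eqrXn2 (n := 2)) ?mulr_ge0 ?norm2_ge0//.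
rewrite exprMn !norm2_sqr !qform1 real_normK ?num_real// mulr_sumr.
by apply/eqP/eq_bigr => i _; rewrite mxE exprMn.
Qed.

Lemma spectral_norm_has_ubound :
  has_ubound [set norm2 (B *m x) | x in [set x : 'cV[R]_n | norm2 x <= 1]].
Proof.
exists (Num.sqrt (\sum_i (\sum_j `|B i j|) ^+ 2)) => _ [x /= x1 <-].
rewrite /norm2 ler_sqrt; last first.
  by rewrite sumr_ge0// => i _; exact: sqr_ge0.
apply: ler_sum => i _; rewrite -real_normK ?num_real//.
rewrite ler_pXn2r ?nnegrE ?normr_ge0 ?sumr_ge0// mxE.
rewrite (le_trans (ler_norm_sum _ _ _))//; apply: ler_sum => j _.
rewrite normrM ler_piMr//.
have : qform 1%:M x <= 1.
  by rewrite -norm2_sqr -[1](expr1n _ 2) ler_pXn2r ?nnegrE ?norm2_ge0.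
rewrite qform1 (bigD1 j)//= => xj1.
rewrite -(ler_pXn2r (n := 2)) ?nnegrE// expr1n real_normK ?num_real//.
apply: le_trans xj1; rewrite lerDl sumr_ge0// => i' _; exact: sqr_ge0.
Qed.

Lemma spectral_norm_ge0 : 0 <= spectral_norm B.
Proof.
have norm20 : norm2 (0 : 'cV[R]_n) <= 1.
  by rewrite -[0](scale0r 0) norm2Z normr0 mul0r ler01.
apply: (le_trans (norm2_ge0 (B *m 0))).
by apply: (ub_le_sup spectral_norm_has_ubound); exists 0.
Qed.

Lemma norm2_mul_le x : norm2 (B *m x) <= spectral_norm B * norm2 x.
Proof.
have [x0|x0] := eqVneq (norm2 x) 0.
  have -> : x = 0.
    apply/eqP; apply: contraTT isT => /qform1_gt0.
    by rewrite -norm2_sqr x0 expr0n ltxx.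
  by rewrite mulmx0 -[0](scale0r 0) norm2Z normr0 mul0r mulr_ge0 ?norm2_ge0
    ?spectral_norm_ge0.
have x1 : 0 < norm2 x by rewrite lt_neqAle eq_sym x0 norm2_ge0.
rewrite -ler_pdivrMr//.
apply: (ub_le_sup spectral_norm_has_ubound); exists ((norm2 x)^-1 *: x) => /=.
  by rewrite norm2Z ger0_norm ?invr_ge0 ?norm2_ge0// mulVf.
by rewrite -scalemxAr norm2Z ger0_norm ?invr_ge0 ?norm2_ge0// mulrC.
Qed.

Lemma qform_le_spectral_norm x :
  qform B x <= spectral_norm B * qform 1%:M x.
Proof.
set S := spectral_norm B.
have qE : qform B x = \sum_i x i 0 * (B *m x) i 0.
  by rewrite /qform -mulmxA mxE; apply: eq_bigr => i _; rewrite mxE.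
have Bx : qform 1%:M (B *m x) <= S ^+ 2 * qform 1%:M x.
  rewrite -!norm2_sqr -exprMn ler_pXn2r ?nnegrE ?norm2_ge0//.
    exact: norm2_mul_le.
  by rewrite mulr_ge0 ?norm2_ge0 ?spectral_norm_ge0.
have [S0|S0] := eqVneq S 0.
  have Bx0 : B *m x = 0.
    apply/eqP; apply: contraTT isT => /qform1_gt0.
    by rewrite ltNge => /negP; case; move: Bx; rewrite S0 expr0n mul0r.
  by rewrite S0 mul0r qE big1// => i _; rewrite Bx0 mxE mulr0.
have Sgt0 : 0 < S by rewrite lt_neqAle eq_sym S0 spectral_norm_ge0.
(* Cauchy-Schwarz in the form [2 S u v <= (S u)^2 + v^2] *)
rewrite -(ler_pM2l (mulr_gt0 (ltr0Sn R 1) Sgt0)).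
have -> : 2 * S * (S * qform 1%:M x) =
    S ^+ 2 * qform 1%:M x + S ^+ 2 * qform 1%:M x by ring.
apply: le_trans (lerD (lexx _) Bx).
rewrite qE !qform1 !mulr_sumr -big_split /=; apply: ler_sum => i _.
move: (x i 0) ((B *m x) i 0) => u v; have := sqr_ge0 (S * u - v).
by rewrite -subr_ge0; congr (0 <= _); ring.
Qed.

End spectral_norm.

(** * Freezing one factor of a Kronecker product *)

(** For fixed [y], the form [x |-> qform B (x *t y)] is quadratic in [x], with
    matrix [slice y].  Its trace is a quadratic form in [y], with matrix
    [partial_trace], the sum of the diagonal blocks of [B]; the trace of the
    latter is [\tr B]. *)
Section tensor.
Context {R : realType} {m n : nat}.

Definition tens_mxl (y : 'cV[R]_n) : 'M[R]_(m * n, m) :=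
  \matrix_(i, j) (((mxtens_unindex i).1 == j)%:R * y (mxtens_unindex i).2 0).

Definition tens_mxr (x : 'cV[R]_m) : 'M[R]_(m * n, n) :=
  \matrix_(i, j) (x (mxtens_unindex i).1 0 * ((mxtens_unindex i).2 == j)%:R).

Lemma tens_mxlE (x : 'cV[R]_m) (y : 'cV[R]_n) : x *t y = tens_mxl y *m x.
Proof.
apply/matrixP => i j; rewrite !mxE (bigD1 (mxtens_unindex i).1)//= mxE eqxx.
rewrite mul1r big1 ?addr0 => [|k ki]; last first.
  by rewrite mxE /= eq_sym (negbTE ki) !mul0r.
by rewrite mulrC !ord1.
Qed.

Lemma tens_mxrE (x : 'cV[R]_m) (y : 'cV[R]_n) : x *t y = tens_mxr x *m y.
Proof.
apply/matrixP => i j; rewrite !mxE (bigD1 (mxtens_unindex i).2)//= mxE eqxx.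
rewrite mulr1 big1 ?addr0 => [|k ki]; last first.
  by rewrite mxE /= (eq_sym _ k) (negbTE ki) mulr0 mul0r.
by rewrite !ord1.
Qed.

Lemma qform1_tens (x : 'cV[R]_m) (y : 'cV[R]_n) :
  qform 1%:M (x *t y) = qform 1%:M x * qform 1%:M y.
Proof.
rewrite !qform1 mulr_sum; apply: eq_bigr => i _.
by rewrite mxE exprMn !ord1.
Qed.

Lemma tens_delta (i : 'I_m) (j : 'I_n) :
  (delta_mx i 0 : 'cV[R]_m) *t (delta_mx j 0 : 'cV[R]_n) =
  delta_mx (mxtens_index (i, j)) 0.
Proof.
apply/colP => k; case: (mxtens_indexP k) => i' j'.
rewrite !mxE mxtens_indexK /= !ord1 !eqxx !andbT -natrM mulnb.
by rewrite (inj_eq (can_inj (@mxtens_indexK m n))) xpair_eqE.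
Qed.

Lemma mxtrace_qform p (C : 'M[R]_p) : \tr C = \sum_i qform C (delta_mx i 0).
Proof.
apply: eq_bigr => i _.
by rewrite /qform trmx_delta -rowE -colE !mxE.
Qed.

Lemma psd_trace_ge0 p (C : 'M[R]_p) : psd C -> 0 <= \tr C.
Proof. by move=> [_ C0]; rewrite mxtrace_qform sumr_ge0. Qed.

Lemma psd_conj p q (C : 'M[R]_p) (K : 'M[R]_(p, q)) :
  psd C -> psd (K^T *m C *m K).
Proof.
move=> [CT C0]; split; first by rewrite !trmx_mul trmxK CT mulmxA.
by move=> x; rewrite -qform_mul.
Qed.

Variable B : 'M[R]_(m * n).

Definition slice (y : 'cV[R]_n) : 'M[R]_m := (tens_mxl y)^T *m B *m tens_mxl y.

Definition partial_trace : 'M[R]_n :=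
  \sum_(i < m) (tens_mxr (delta_mx i 0))^T *m B *m tens_mxr (delta_mx i 0).

Lemma qform_slice y x : qform (slice y) x = qform B (x *t y).
Proof. by rewrite /slice -qform_mul tens_mxlE. Qed.

Lemma qform_partial_trace y :
  qform partial_trace y = \sum_(i < m) qform B ((delta_mx i 0 : 'cV[R]_m) *t y).
Proof.
have qD := fun A C => qformD A C y.
rewrite (big_morph _ qD (_ : qform 0 y = 0)); last first.
  by rewrite /qform mulmx0 mul0mx mxE.
by apply: eq_bigr => i _; rewrite -qform_mul tens_mxrE.
Qed.

Lemma tr_slice y : \tr (slice y) = qform partial_trace y.
Proof.
rewrite mxtrace_qform qform_partial_trace.
by apply: eq_bigr => i _; rewrite qform_slice.
Qed.

Lemma tr_partial_trace : \tr partial_trace = \tr B.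
Proof.
rewrite !mxtrace_qform; under eq_bigr do rewrite qform_partial_trace.
rewrite exchange_big pair_big /= (reindex (@mxtens_unindex m n)) /=; last first.
  exists (@mxtens_index m n) => i _;
    by rewrite (mxtens_indexK, mxtens_unindexK).
by apply: eq_bigr => k _; rewrite tens_delta mxtens_unindexK.
Qed.

Lemma psd_slice y : psd B -> psd (slice y).
Proof. exact: psd_conj. Qed.

Lemma psd_partial_trace : psd B -> psd partial_trace.
Proof.
move=> Bpsd; split.
  rewrite /partial_trace raddf_sum /=; apply: eq_bigr => i _.
  by case: (psd_conj (tens_mxr (delta_mx i 0)) Bpsd).
by move=> y; rewrite qform_partial_trace sumr_ge0// => i _; apply: Bpsd.2.
Qed.

Lemma qform_slice_le y x : qform (slice y) x <=
  spectral_norm B * qform 1%:M y * qform 1%:M x.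
Proof.
rewrite qform_slice (le_trans (qform_le_spectral_norm _ _))//.
by rewrite qform1_tens mulrAC mulrA.
Qed.

Lemma qform_partial_trace_le y : qform partial_trace y <=
  m%:R * spectral_norm B * qform 1%:M y.
Proof.
rewrite qform_partial_trace -mulrA mulr_natl.
have -> : spectral_norm B * qform 1%:M y *+ m =
    \sum_(i < m) spectral_norm B * qform 1%:M y by rewrite sumr_const card_ord.
apply: ler_sum => i _; rewrite (le_trans (qform_le_spectral_norm _ _))//.
rewrite qform1_tens ler_wpM2l ?spectral_norm_ge0// ler_piMl ?qform1_ge0//.
rewrite qform1 (bigD1 i)//= mxE !eqxx expr1n big1 ?addr0// => j ji.
by rewrite mxE (negbTE ji) expr0n.
Qed.

End tensor.

(** * Independence and product laws *)

Section independence.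
Context {d d1 d2} {T : measurableType d} {T1 : measurableType d1}
  {T2 : measurableType d2} {R : realType}.
Variables (P : probability T R).
Local Open Scope ereal_scope.

Lemma mfun_measurable_preimage d' (T' : measurableType d')
    (Z : {mfun T >-> T'}) B : measurable B -> measurable (Z @^-1` B).
Proof. by move=> mB; rewrite -[_ @^-1` _]setTI; exact: measurable_funP. Qed.

(** Dynkin's pi-lambda argument: the sets for which the product rule holds form
    a lambda-system. *)
Lemma indep_extend d' (T' : measurableType d') (Z : {mfun T >-> T'})
    (G : set_system T') (D : set T) :
  measurable = <<s G>> -> setI_closed G -> measurable D ->
  (forall B, G B -> P (D `&` Z @^-1` B) = P D * P (Z @^-1` B)) ->
  forall B, measurable B -> P (D `&` Z @^-1` B) = P D * P (Z @^-1` B).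
Proof.
move=> mG GI mD DG B; rewrite [X in X B -> _]mG.
apply: (dynkin_induction
  (P := [set B | P (D `&` Z @^-1` B) = P D * P (Z @^-1` B)])) => //=.
- by rewrite preimage_setT setIT probability_setT mule1.
- move=> S mS E; have mZS := mfun_measurable_preimage Z mS.
  have PD : P D < +oo by rewrite -ge0_fin_numE// fin_num_measure.
  have -> : Z @^-1` (~` S) = ~` (Z @^-1` S) by [].
  transitivity (P D - P (D `&` Z @^-1` S)); first exact: measureD.
  rewrite E probability_setC// muleBr ?fin_num_measure//.
  by rewrite mule1.
- move=> F mF tF E.
  have tZF : trivIset setT (fun n => Z @^-1` F n).
    apply/trivIsetP => i j _ _ ij; rewrite -preimage_setI.
    by move/trivIsetP : tF => ->//; rewrite preimage_set0.
  rewrite preimage_bigcup setI_bigcupr !measure_bigcup//=.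
  + rewrite -[in RHS](fineK (fin_num_measure P D mD)) -nneseriesZl//.
    by apply: eq_eseriesr => n _; rewrite fineK ?fin_num_measure//; exact: E.
  + by move=> n _; exact: mfun_measurable_preimage.
  + by move=> n _; apply: measurableI => //; exact: mfun_measurable_preimage.
  + exact: trivIset_setIl.
Qed.

Variables (X : {mfun T >-> T1}) (Y : {mfun T >-> T2}).
Variables (G1 : set_system T1) (G2 : set_system T2).
Hypotheses (mG1 : measurable = <<s G1>>) (G1I : setI_closed G1).
Hypotheses (mG2 : measurable = <<s G2>>) (G2I : setI_closed G2).
Hypothesis XY : forall A B, G1 A -> G2 B ->
  P (X @^-1` A `&` Y @^-1` B) = P (X @^-1` A) * P (Y @^-1` B).

Lemma indep_pair A B : measurable A -> measurable B ->
  P (X @^-1` A `&` Y @^-1` B) = P (X @^-1` A) * P (Y @^-1` B).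
Proof.
move=> mA mB; rewrite setIC muleC.
have mYB := mfun_measurable_preimage Y mB.
apply: (indep_extend mG1 G1I mYB) => // {mA}A GA.
rewrite setIC muleC.
have mA : measurable A by rewrite mG1; exact: sub_sigma_algebra.
apply: (indep_extend mG2 G2I (mfun_measurable_preimage X mA)) => //.
by move=> C GC; exact: XY.
Qed.

(** The joint law of independent [X] and [Y] is the product of their laws, so
    that Tonelli's theorem applies. *)
Lemma indep_integral (f : T1 * T2 -> \bar R) :
  measurable_fun setT f -> (forall z, 0 <= f z) ->
  \int[P]_t f (X t, Y t) =
  \int[distribution P Y]_y \int[distribution P X]_x f (x, y).
Proof.
move=> mf f0.
have mXY : measurable_fun setT (fun t => (X t, Y t)).
  by apply/measurable_fun_pairP; split; exact: measurable_funP.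
pose Z : {mfun T >-> (T1 * T2)%type} :=
  HB.pack (fun t => (X t, Y t)) (isMeasurableFun.Build _ _ _ _ _ mXY).
rewrite -(fubini_tonelli2 f)//.
transitivity (\int[distribution P Z]_z f z).
  by rewrite ge0_integral_distribution.
apply: eq_measure_integral => /= A mA _; apply/esym.
apply: product_measure_unique => // B C mB mC.
exact: indep_pair.
Qed.

End independence.

Section tuples.
Context {d} {S : measurableType d}.

Definition tuple_rect n (A : 'I_n -> set S) : set (n.-tuple S) :=
  [set t | forall i, A i (tnth t i)].

Definition tuple_rects n : set_system (n.-tuple S) :=
  [set tuple_rect A | A in [set A | forall i, measurable (A i)]].

Lemma measurable_tuple_rect n (A : 'I_n -> set S) :
  (forall i, measurable (A i)) -> measurable (tuple_rect A).
Proof.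
move=> mA; rewrite [X in measurable X](_ : _ =
    \bigcap_(i in setT) ((fun t => tnth t i) @^-1` A i)); last first.
  by apply/seteqP; split => [t At i _|t At i]; exact: At.
apply: fin_bigcap_measurable => // i _; rewrite -[X in measurable X]setTI.
exact: measurable_tnth.
Qed.

Lemma tuple_rects_generate n :
  measurable = <<s @tuple_rects n>> :> set_system (n.-tuple S).
Proof.
rewrite eqEsubset; split; apply: smallest_sub.
- exact: smallest_sigma_algebra.
- rewrite -bigcup_seq /= => C [i _ [A mA <-]].
  apply: sub_sigma_algebra; exists (fun j => if j == i then A else setT) => /=.
    by move=> j; case: ifP.
  apply/seteqP; split => t /=.
    by move=> /(_ i); rewrite eqxx.
  by move=> [_ At] j; case: eqP => // ->.
- exact: sigma_algebra_measurable.
- by move=> _ [A mA <-]; exact: measurable_tuple_rect.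
Qed.

Lemma tuple_rectI n (A B : 'I_n -> set S) :
  tuple_rect A `&` tuple_rect B = tuple_rect (fun i => A i `&` B i).
Proof.
apply/seteqP; split => t; first by move=> [At Bt] i.
by move=> ABt; split => i; case: (ABt i).
Qed.

Lemma tuple_rects_setI n : setI_closed (@tuple_rects n).
Proof.
move=> _ _ [A mA <-] [B mB <-]; rewrite tuple_rectI.
by exists (fun i => A i `&` B i) => //= i; exact: measurableI.
Qed.

Definition coord n (i : 'I_n) (t : n.-tuple S) : S := tnth t i.

HB.instance Definition _ n (i : 'I_n) :=
  isMeasurableFun.Build _ _ _ _ (@coord n i) (@measurable_tnth _ _ n i).

(** A name for [behead] on tuples, on which the structure of measurable
    function can be declared. *)
Definition tail n (t : n.+1.-tuple S) : n.-tuple S := [tuple of behead t].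

HB.instance Definition _ n :=
  isMeasurableFun.Build _ _ _ _ (@tail n) (@measurable_behead _ _ n).

Lemma tnth_tail n (t : n.+1.-tuple S) i :
  tnth (tail t) i = tnth t (lift ord0 i).
Proof. by rewrite [in RHS](tuple_eta t) tnthS. Qed.

Context {R : realType}.
Local Open Scope ereal_scope.

(** [m] is the product of the laws [mu i].  It is given by its values on boxes,
    which determine it by [tuple_rects_generate] and [tuple_rects_setI]. *)
Definition product_law n (m : probability (n.-tuple S) R)
    (mu : 'I_n -> probability S R) :=
  forall A : 'I_n -> set S, (forall i, measurable (A i)) ->
    m (tuple_rect A) = \prod_(i < n) mu i (A i).

Section peel.
Variables (n : nat) (m : probability (n.+1.-tuple S) R)
  (mu : 'I_n.+1 -> probability S R).
Hypothesis mE : product_law m mu.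

Let cons_sets (B : set S) (A : 'I_n -> set S) (i : 'I_n.+1) : set S :=
  if unlift ord0 i is Some j then A j else B.

Let cons_rect B A :
  coord ord0 @^-1` B `&` @tail n @^-1` tuple_rect A =
  tuple_rect (cons_sets B A).
Proof.
apply/seteqP; split => t /=.
  move=> [Bt At] i; rewrite /cons_sets; case: unliftP => [j|] -> //.
  by rewrite -tnth_tail; exact: At.
move=> BAt; split.
  by have := BAt ord0; rewrite /cons_sets unlift_none.
by move=> i; have := BAt (lift ord0 i); rewrite /cons_sets liftK tnth_tail.
Qed.

Let law_cons B A : measurable B -> (forall i, measurable (A i)) ->
  m (coord ord0 @^-1` B `&` @tail n @^-1` tuple_rect A) =
  mu ord0 B * \prod_(i < n) mu (lift ord0 i) (A i).
Proof.
move=> mB mA; rewrite cons_rect mE; last first.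
  by move=> i; rewrite /cons_sets; case: unliftP.
rewrite big_ord_recl /cons_sets unlift_none; congr (_ * _).
by apply: eq_bigr => i _; rewrite liftK.
Qed.

Lemma tuple_rectT k : tuple_rect (fun _ : 'I_k => setT) = setT.
Proof. by apply/seteqP; split. Qed.

Lemma prode_1 k : \prod_(i < k) (1 : \bar R) = 1.
Proof. by elim: k => [|k IH]; rewrite ?big_ord0// big_ord_recl IH mule1. Qed.

Lemma product_law_coord0 B : measurable B ->
  distribution m (coord ord0) B = mu ord0 B.
Proof.
move=> mB; have := @law_cons B (fun=> setT) mB (fun=> measurableT).
rewrite tuple_rectT preimage_setT setIT => E; apply: etrans E _.
under eq_bigr do rewrite probability_setT.
by rewrite prode_1 mule1.
Qed.

Lemma product_law_tail :
  product_law (distribution m (@tail n)) (fun i => mu (lift ord0 i)).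
Proof.
move=> A mA; have := law_cons measurableT mA.
by rewrite preimage_setT setTI probability_setT mul1e.
Qed.

(** Tonelli's theorem for the first entry of a tuple and the others; it is the
    induction step of every computation with product laws. *)
Lemma product_law_peel (f : S * n.-tuple S -> \bar R) :
  measurable_fun setT f -> (forall z, 0 <= f z) ->
  \int[m]_t f (tnth t ord0, tail t) =
  \int[distribution m (@tail n)]_y \int[mu ord0]_x f (x, y).
Proof.
move=> mf f0.
have mS : measurable = <<s measurable >> :> set_system S.
  rewrite eqEsubset; split => [A|]; first exact: sub_sigma_algebra.
  by apply: smallest_sub => //; exact: sigma_algebra_measurable.
rewrite (@indep_integral _ _ _ _ _ _ _ m (coord ord0) (@tail n) measurable
  (@tuple_rects n) mS _ (@tuple_rects_generate n) (@tuple_rects_setI n))//.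
- apply: eq_integral => y _; apply: eq_measure_integral => A mA _.
  exact: product_law_coord0.
- exact: measurableI.
- move=> B _ mB [A mA <-]; rewrite law_cons//.
  by rewrite -product_law_coord0// -product_law_tail.
Qed.

End peel.

Lemma product_law_prod n (m : probability (n.-tuple S) R)
    (mu : 'I_n -> probability S R) (f : 'I_n -> S -> R) (c : 'I_n -> R) :
  product_law m mu ->
  (forall i, measurable_fun setT (f i)) -> (forall i x, (0 <= f i x)%R) ->
  (forall i, (0 <= c i)%R) ->
  (forall i, \int[mu i]_x (f i x)%:E <= (c i)%:E) ->
  \int[m]_t (\prod_(i < n) f i (tnth t i))%R%:E <= (\prod_(i < n) c i)%R%:E.
Proof.
elim: n m mu f c => [|n IH] m mu f c mE mf f0 c0 fc.
  under eq_integral do rewrite big_ord0.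
  by rewrite big_ord0 integral_cst//= probability_setT mule1.
pose g (y : n.-tuple S) := (\prod_(i < n) f (lift ord0 i) (tnth y i))%R.
have g0 y : (0 <= g y)%R by rewrite prodr_ge0.
have mg : measurable_fun setT g.
  by apply: measurable_prod => i _; apply: measurableT_comp => //;
    exact: measurable_tnth.
have fE t : (\prod_(i < n.+1) f i (tnth t i))%R%:E =
    (f ord0 (tnth t ord0))%:E * (g (tail t))%:E.
  rewrite big_ord_recl EFinM; congr (_ * (_)%:E).
  by apply: eq_bigr => i _; rewrite tnth_tail.
under eq_integral do rewrite fE.
pose F (z : S * n.-tuple S) := (f ord0 z.1)%:E * (g z.2)%:E.
have mF : measurable_fun setT F.
  by apply: emeasurable_funM; apply/measurable_EFinP; apply: measurableT_comp.
have F0 z : 0 <= F z by rewrite /F -EFinM lee_fin mulr_ge0.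
rewrite (product_law_peel mE mF F0).
apply: (@le_trans _ _
    (\int[distribution m (@tail n)]_y ((c ord0)%:E * (g y)%:E))).
  apply: ge0_le_integral => //.
  - by move=> y _; apply: integral_ge0 => x _; exact: F0.
  - exact: (measurable_fun_fubini_tonelli_G (m1 := mu ord0) F mF F0).
  - by apply: emeasurable_funM => //; exact/measurable_EFinP.
  - move=> y _; rewrite /F /= ge0_integralZr//=.
    + by rewrite lee_wpmul2r// lee_fin.
    + exact/measurable_EFinP.
    + by move=> x _; rewrite lee_fin.
    + by rewrite lee_fin.
rewrite ge0_integralZl//=; last 3 first.
- exact/measurable_EFinP.
- by move=> *; rewrite lee_fin.
- by rewrite lee_fin.
rewrite big_ord_recl EFinM lee_pmul// ?lee_fin// ?integral_ge0//.
  by move=> y _; rewrite lee_fin.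
by apply: (IH _ _ (fun i => f (lift ord0 i)) (fun i => c (lift ord0 i))
  (product_law_tail mE)).
Qed.

End tuples.

(** * Integration against a density *)

Section density.
Context d (T : measurableType d) (R : realType).
Variables (mu nu : {measure set T -> \bar R}) (p : T -> R).
Hypotheses (mp : measurable_fun setT p) (p0 : forall x, 0 <= p x).
Hypothesis nuE :
  forall A, measurable A -> nu A = (\int[mu]_(x in A) (p x)%:E)%E.

Local Open Scope ereal_scope.
Import HBNNSimple.

Let integral_density_indic (A : set T) : measurable A ->
  \int[nu]_x (\1_A x)%:E = \int[mu]_x ((\1_A x)%:E * (p x)%:E).
Proof.
move=> mA; rewrite integral_indic// setIT nuE// integral_mkcond epatch_indic.
by apply: eq_integral => x _; rewrite /= muleC.
Qed.

Let integral_density_nnsfun (f : {nnsfun T >-> R}) :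
  \int[nu]_x (f x)%:E = \int[mu]_x ((f x)%:E * (p x)%:E).
Proof.
under eq_integral do rewrite fimfunE -fsumEFin//.
rewrite ge0_integral_fsum//; last 2 first.
- by move=> r; exact/measurable_EFinP/measurableT_comp.
- by move=> n x _; rewrite EFinM nnfun_muleindic_ge0.
under [RHS]eq_integral.
  move=> x _; rewrite fimfunE -fsumEFin// muleC ge0_mule_fsumr; last first.
    by move=> r; rewrite EFinM nnfun_muleindic_ge0.
  over.
rewrite [RHS]ge0_integral_fsum//; last 2 first.
- move=> r; apply: emeasurable_funM; first exact/measurable_EFinP.
  exact/measurable_EFinP/measurableT_comp.
- move=> n x _; rewrite mule_ge0 => //; first by rewrite lee_fin.
  by rewrite EFinM nnfun_muleindic_ge0.
apply: eq_fsbigr => r; rewrite inE => -[x0 _ fr].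
have r0 : (0 <= r)%R by rewrite -fr.
have mfr : measurable (f @^-1` [set r]) by [].
rewrite integralZl_indic_nnsfun//= integral_density_indic//.
rewrite -ge0_integralZl//=.
- by apply: eq_integral => x _; rewrite [in RHS]EFinM muleA muleC.
- by apply: emeasurable_funM; exact/measurable_EFinP.
- by move=> x _; rewrite mule_ge0// lee_fin.
Qed.

(** By monotone convergence from simple functions. *)
Lemma integral_density (f : T -> \bar R) :
  measurable_fun setT f -> (forall x, 0 <= f x) ->
  \int[nu]_x f x = \int[mu]_x (f x * (p x)%:E).
Proof.
move=> mf f0; pose f_ := nnsfun_approx measurableT mf.
have f_cvg x : f x = limn (fun n => (f_ n x)%:E).
  by apply/esym/cvg_lim => //; exact: cvg_nnsfun_approx.
have f_nd x : {homo (fun n => (f_ n x)%:E) : a b / (a <= b)%N >-> a <= b}.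
  by move=> a b ab; rewrite lee_fin; exact/lefP/nd_nnsfun_approx.
transitivity (limn (fun n => \int[nu]_x (f_ n x)%:E)).
  rewrite -monotone_convergence//=.
  - by apply: eq_integral => x _; exact: f_cvg.
  - by move=> n; exact/measurable_EFinP/measurable_funTS.
  - by move=> n x _; rewrite lee_fin.
under eq_fun do rewrite integral_density_nnsfun.
rewrite -monotone_convergence//=.
- apply: eq_integral => x _; rewrite f_cvg limeMr//.
  exact: ereal_nondecreasing_is_cvgn.
- by move=> n; apply: emeasurable_funM; exact/measurable_EFinP.
- by move=> n x _; rewrite mule_ge0 ?lee_fin.
- by move=> x _ a b ab; rewrite lee_wpmul2r ?lee_fin//; have := f_nd x _ _ ab;
    rewrite lee_fin.
Qed.

End density.

(** * Inequalities for the exponential function *)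

Section exponential_bounds.
Context {R : realType}.
Implicit Types a b x y : R.

Lemma ge0_derive_ge_at0 (f df : R -> R) : (forall x, is_derive x 1 f (df x)) ->
  (forall x, 0 <= x -> 0 <= df x) -> forall x, 0 <= x -> f 0 <= f x.
Proof.
move=> fdf df0 x x0.
have cf : {within `[0, x], continuous f}.
  apply: derivable_within_continuous => y _.
  exact: (@ex_derive _ _ _ _ _ _ _ (fdf y)).
have [c + /eqP] := MVT_segment x0 (fun y _ => fdf y) cf.
rewrite in_itv /= => /andP[c0 _]; rewrite subr_eq => /eqP ->.
by rewrite lerDr mulr_ge0 ?df0// subr0.
Qed.

Lemma is_derive_expR_comp (g : R -> R) dg x : is_derive x 1 g dg ->
  is_derive x 1 (expR \o g) (expR (g x) * dg).
Proof. by move=> gdg; exact: is_derive1_comp. Qed.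

Lemma expR_ge_taylor x n : 0 <= x ->
  \sum_(0 <= i < n) x ^+ i / i`!%:R <= expR x.
Proof.
move=> x0; apply: (nondecreasing_cvgn_le (u_ := series (exp_coeff x))).
  apply/nondecreasing_seqP => m; rewrite -subr_ge0 seriesSB.
  exact: exp_coeff_ge0.
exact: is_cvg_series_exp_coeff.
Qed.

Lemma expR_ge_quadratic x : 0 <= x -> 1 + x + x ^+ 2 / 2 <= expR x.
Proof.
move=> /(expR_ge_taylor 3); rewrite !big_nat_recr ?big_geq//= add0r.
by rewrite expr0 expr1 !divr1.
Qed.

Lemma sinh_le x : 0 <= x -> expR x - expR (- x) <= x * (expR x + expR (- x)).
Proof.
move=> x0.
pose f : R -> R := id * (expR + (expR \o -%R)) - (expR - (expR \o -%R)).
have fd y : is_derive y 1 f (y * (expR y - expR (- y))).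
  have eN : is_derive y 1 (expR \o -%R) (expR (- y) * - 1).
    exact: is_derive_expR_comp.
  by apply: is_derive_eq; rewrite !fctE /GRing.scale /=; ring.
have df0 y : 0 <= y -> 0 <= y * (expR y - expR (- y)).
  by move=> y0; rewrite mulr_ge0// subr_ge0 ler_expR ge0_cp.
have := ge0_derive_ge_at0 fd df0 x0; rewrite /f !fctE /= oppr0 expR0; lra.
Qed.

(** [exp (- x^2 / 2) cosh x] is nonincreasing on the nonnegative reals, because
    [sinh x <= x cosh x] there. *)
Lemma cosh_le x : (expR x + expR (- x)) / 2 <= expR (x ^+ 2 / 2).
Proof.
wlog x0 : x / 0 <= x => [H|].
  have [/H//|/ltW x0] := leP 0 x.
  by have := H (- x); rewrite opprK sqrrN [expR (- x) + _]addrC; apply;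
    rewrite oppr_ge0.
pose e : R -> R := expR \o (- (2^-1 *: (id ^+ 2))).
pose f : R -> R := - (e * (expR + (expR \o -%R))).
have fd y : is_derive y 1 f
    (e y * (y * (expR y + expR (- y)) - (expR y - expR (- y)))).
  have eN : is_derive y 1 (expR \o -%R) (expR (- y) * - 1).
    exact: is_derive_expR_comp.
  have ed : is_derive y 1 e (e y * - y).
    apply: is_derive_expR_comp.
    by apply: is_derive_eq; rewrite /GRing.scale /=; field.
  by apply: is_derive_eq; rewrite !fctE /GRing.scale /=; ring.
have df0 y : 0 <= y ->
    0 <= e y * (y * (expR y + expR (- y)) - (expR y - expR (- y))).
  by move=> y0; rewrite mulr_ge0 ?expR_ge0// subr_ge0 sinh_le.
have := ge0_derive_ge_at0 fd df0 x0; rewrite /f /e !fctE /= oppr0 expR0.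
rewrite /GRing.scale /= expr0n mulr0 oppr0 expR0 mul1r lerN2.
rewrite [expR (- (_ * _))]expRN ler_pdivrMl ?expR_gt0// => H.
by rewrite ler_pdivrMr// (le_trans H)// [2^-1 * _]mulrC -[1 + 1]/(2%:R).
Qed.

End exponential_bounds.

(** * The moment generating function of a quadratic form *)

Section quadratic_mgf.
Context {R : realType}.
Implicit Types a b x : R.

(** The right-hand side is the value of the integral for the standard Gaussian
    law.  Both the Gaussian and the Rademacher law satisfy this, and it is all
    that the estimates of moment generating functions use. *)
Definition gaussian_dominated (mu : probability R R) :=
  forall a b, 0 <= a -> 2 * a < 1 ->
    (\int[mu]_x (expR (a * x ^+ 2 + b * x))%:E <=
     ((Num.sqrt (1 - 2 * a))^-1 * expR (b ^+ 2 / (2 * (1 - 2 * a))))%:E)%E.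

Lemma measurable_expR_quadratic a b :
  measurable_fun [set: R] (fun x => expR (a * x ^+ 2 + b * x)).
Proof.
apply: measurableT_comp => //; apply: measurable_funD.
  by apply: measurable_funM => //; exact: measurable_funX.
exact: measurable_funM.
Qed.

(** Completing the square turns the integrand times the standard normal density
    into a constant multiple of another normal density. *)
Lemma normal_gaussian_dominated (mu : probability R R) :
  (forall A, measurable A -> mu A = normal_prob 0 1 A) -> gaussian_dominated mu.
Proof.
move=> muE a b a0 a1.
have d0 : 0 < 1 - 2 * a by rewrite subr_gt0.
pose s := (Num.sqrt (1 - 2 * a))^-1.
have s0 : 0 < s by rewrite invr_gt0 sqrtr_gt0.
have s2 : s ^+ 2 = (1 - 2 * a)^-1 by rewrite exprVn sqr_sqrtr// ltW.
pose K := s * expR (b ^+ 2 / (2 * (1 - 2 * a))).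
(* [mu] is moved along the identity to the copy of the real line, with the same
   measurable sets, on which the Lebesgue measure is defined *)
have mid : measurable_fun setT (idfun : R -> measurableTypeR R).
  by move=> _ A mA; rewrite setTI preimage_id.
pose idR : {mfun R >-> measurableTypeR R} :=
  HB.pack idfun (isMeasurableFun.Build _ _ _ _ _ mid).
have mf : measurable_fun [set: measurableTypeR R]
    (fun x : measurableTypeR R => (expR (a * x ^+ 2 + b * x))%:E).
  have mfR : measurable_fun [set: R]
      (fun x : R => (expR (a * x ^+ 2 + b * x))%:E).
    apply/measurable_EFinP; exact: measurable_expR_quadratic.
  by move=> mT A mA; exact: mfR.
have f0 (x : measurableTypeR R) : (0 <= (expR (a * x ^+ 2 + b * x))%:E)%E.
  by rewrite lee_fin expR_ge0.
have -> : (\int[mu]_x (expR (a * x ^+ 2 + b * x))%:E =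
    \int[distribution mu idR]_x (expR (a * x ^+ 2 + b * x))%:E)%E.
  by rewrite ge0_integral_distribution.
rewrite (@integral_density _ _ _ lebesgue_measure (distribution mu idR) _
  (measurable_normal_pdf 0 1) (normal_pdf_ge0 0 1))//.
have E (x : R) : ((expR (a * x ^+ 2 + b * x))%:E * (normal_pdf 0 1 x)%:E =
    K%:E * (normal_pdf (b / (1 - 2 * a)) s x)%:E)%E.
  rewrite -!EFinM; congr (_%:E).
  rewrite !normal_pdfE ?oner_eq0 ?gt_eqF// /normal_peak /normal_fun s2.
  rewrite expr1n mul1r -mulrnAr sqrtrM ?invr_ge0 ?ltW// sqrtrV ?ltW// -/s.
  rewrite [LHS]mulrCA -expRD [RHS]mulrACA -expRD.
  rewrite (_ : s / (s * _) = (Num.sqrt (pi *+ 2))^-1); last first.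
    by rewrite invfM mulVKf ?gt_eqF.
  congr (_ * expR _).
  by field; rewrite gt_eqF.
under eq_integral do rewrite E.
rewrite ge0_integralZl//=.
- by rewrite integral_normal_pdf mule1.
- by apply/measurable_EFinP; exact: measurable_normal_pdf.
- by move=> x _; rewrite lee_fin normal_pdf_ge0.
- by rewrite lee_fin mulr_ge0 ?expR_ge0 ?ltW.
Qed.

(** The integral is [exp a cosh b], and [exp a <= (1 - 2 a)^(-1/2)]. *)
Lemma rademacher_gaussian_dominated (mu : probability R R) :
  mu [set 1] = (2^-1)%:E -> mu [set -1] = (2^-1)%:E -> gaussian_dominated mu.
Proof.
move=> mu1 muN1 a b a0 a1.
have d0 : 0 < 1 - 2 * a by rewrite subr_gt0.
pose f x : \bar R := (expR (a * x ^+ 2 + b * x))%:E.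
have f0 x : (0 <= f x)%E by rewrite lee_fin expR_ge0.
have mf : measurable_fun setT f.
  by apply/measurable_EFinP; exact: measurable_expR_quadratic.
pose N : set R := [set 1; -1].
have dN : [disjoint [set 1] & [set -1 : R]].
  apply/disj_setPS => x [/= -> ] /eqP; rewrite -subr_eq0 opprK.
  by rewrite paddr_eq0 ?ler01// oner_eq0.
have mN : measurable N by exact: measurableU.
have muN : mu N = 1%E.
  transitivity (mu [set 1%R] + mu [set (-1)%R])%E.
    by apply: measureU => //; exact/disj_set2P.
  by rewrite mu1 muN1 -EFinD; congr (_%:E); field.
have f1 (r : R) : (\int[mu]_(x in [set r]) f x = f r * mu [set r])%E.
  rewrite -integral_cst//.
  by apply: eq_integral => x; rewrite inE => ->.
rewrite -[X in integral _ X _](setUv N).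
rewrite ge0_integral_setU//; last 3 first.
- exact: measurableC.
- by rewrite setUv.
- exact/disj_set2P/setICr.
rewrite [X in (_ + X)%E](_ : _ = 0%E) ?adde0; last first.
  apply: null_set_integral => //.
  - exact: measurableC.
  - exact: measurable_funTS.
  - by apply: etrans (probability_setC mu mN) _; rewrite muN subee.
rewrite -/f /N ge0_integral_setU//; last exact: measurable_funTS.
rewrite !f1 mu1 muN1 /f -!EFinM -EFinD lee_fin.
rewrite sqrrN expr1n !mulr1 mulrN1 !expRD -mulrDl -mulrDr -mulrA.
apply: ler_pM.
- exact: expR_ge0.
- by rewrite divr_ge0 ?addr_ge0 ?expR_ge0.
- rewrite -[expR a]invrK lef_pV2 ?posrE ?invr_gt0 ?expR_gt0 ?sqrtr_gt0//.
  rewrite -expRN -(ler_pXn2r (n := 2)) ?nnegrE ?expR_ge0//.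
  rewrite sqr_sqrtr; last exact: ltW.
  by rewrite -expRM_natl (le_trans _ (expR_ge1Dx _))// mulrN.
- apply: (le_trans (cosh_le b)); rewrite ler_expR.
  rewrite ler_wpM2l ?sqr_ge0// lef_pV2 ?posrE ?mulr_gt0//.
  by rewrite ler_piMr// gerBl mulr_ge0.
Qed.

Lemma measurable_qform d (T : measurableType d) n (B : 'M[R]_n)
    (v : T -> 'cV[R]_n) : (forall i, measurable_fun setT (fun t => v t i 0)) ->
  measurable_fun setT (fun t => qform B (v t)).
Proof.
move=> mv; under eq_fun do rewrite qformE.
apply: measurable_sum => i; apply: measurable_sum => j.
by apply: measurable_funM => //; apply: measurable_funM.
Qed.

Lemma measurable_qform_colv n (B : 'M[R]_n) :
  measurable_fun setT (fun t : n.-tuple R => qform B (colv t)).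
Proof.
apply: measurable_qform => i; under eq_fun do rewrite mxE.
exact: measurable_tnth.
Qed.

Lemma colv_cons n (t : n.+1.-tuple R) :
  colv t = col_mx (tnth t ord0)%:M (colv (tail t)) :> 'cV[R]_(1 + n).
Proof.
apply/colP => i; case: (split_ordP i) => j ->.
  rewrite col_mxEu !mxE (ord1 j) eqxx mulr1n.
  by congr (tnth t _); apply: val_inj.
by rewrite col_mxEd !mxE tnth_tail; congr (tnth t _); apply: val_inj.
Qed.

(** Induction on the number of entries: integrating over the first one replaces
    [C] by its [schur_C] and multiplies by [(1 - 2 c)^(-1/2)].  For Gaussian
    entries the inequality is an equality. *)
Lemma qform_mgf_det n (m : probability (n.-tuple R) R)
    (mu : 'I_n -> probability R R) (C : 'M[R]_n) :
  product_law m mu -> (forall i, gaussian_dominated (mu i)) -> psd C ->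
  (forall x : 'cV[R]_n, x != 0 -> 0 < qform (1%:M - 2 *: C) x) ->
  (\int[m]_t (expR (qform C (colv t)))%:E <=
   ((Num.sqrt (\det (1%:M - 2 *: C)))^-1)%:E)%E.
Proof.
elim: n m mu C => [|n IH] m mu C mE mug Cpsd Cpd.
  under eq_integral do rewrite qformE big_ord0 expR0.
  by rewrite det_mx00 sqrtr1 invr1 integral_cst//= probability_setT mule1.
change ('M[R]_(1 + n)) in (type of C).
pose c := schur_c C; pose b := schur_b C.
pose dot (y : 'cV[R]_n) := (b^T *m y) 0 0.
pose F (z : R * n.-tuple R) : \bar R :=
  (expR (qform C (col_mx z.1%:M (colv z.2))))%:E.
have mF : measurable_fun setT F.
  apply/measurable_EFinP; apply: measurableT_comp => //.
  apply: measurable_qform => i; case: (split_ordP i) => j ->.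
    under eq_fun do rewrite col_mxEu mxE (ord1 j) eqxx mulr1n.
    exact: measurable_fst.
  under eq_fun do rewrite col_mxEd mxE.
  exact: (measurableT_comp (measurable_tnth j) measurable_snd).
have F0 z : (0 <= F z)%E by rewrite lee_fin expR_ge0.
under eq_integral do rewrite colv_cons.
rewrite (product_law_peel mE mF F0).
have c0 : 0 <= c by exact: schur_c_ge0.
have c1 : 2 * c < 1 by exact: schur_c_lt.
apply: (@le_trans _ _ (\int[distribution m (@tail _ _ n)]_y
    ((Num.sqrt (1 - 2 * c))^-1%:E * (expR (qform (schur_C C) (colv y)))%:E))%E).
  apply: ge0_le_integral => //.
  - by move=> y _; apply: integral_ge0 => x _; exact: F0.
  - exact: (measurable_fun_fubini_tonelli_G (m1 := mu ord0) F mF F0).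
  - apply: emeasurable_funM => //; apply/measurable_EFinP.
    by apply: measurableT_comp => //; exact: measurable_qform_colv.
  - move=> y _; rewrite /F /=.
    rewrite (eq_integral (fun x =>
      (expR (c * x ^+ 2 + 2 * dot (colv y) * x))%:E *
      (expR (qform (drsubmx C) (colv y)))%:E)%E); last first.
      by move=> x _; rewrite qform_block// expRD EFinM.
    rewrite ge0_integralZr//=; last first.
      by apply/measurable_EFinP; exact: measurable_expR_quadratic.
    apply: (le_trans (lee_wpmul2r _ (mug ord0 _ _ c0 c1))).
      by rewrite lee_fin expR_ge0.
    rewrite -!EFinM lee_fin -mulrA -expRD.
    rewrite (_ : _ + _ = qform (schur_C C) (colv y))// qform_schur// addrC.
    by congr (_ + _); rewrite /dot -/c -/b; field; rewrite subr_eq0 gt_eqF.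
rewrite ge0_integralZl//=; last first.
  apply/measurable_EFinP; apply: measurableT_comp => //.
  exact: measurable_qform_colv.
rewrite det_schur// sqrtrM; last by rewrite subr_ge0 ltW.
rewrite invfM EFinM lee_wpmul2l// ?lee_fin ?invr_ge0 ?sqrtr_ge0//.
apply: IH (product_law_tail mE) _ (schur_psd _ _) (schur_pd _ _) => //.
Qed.

End quadratic_mgf.

Section trace_mgf.
Context {R : realType}.
Implicit Types a l : R.

(** The bound on [log E exp (qform C)] is the mean [\tr C] of the form times
    this factor, where [l] bounds the form on unit vectors.  It comes from
    [- log (1 - 2 a) / 2 <= a + a^2 / (1 - 2 a) = a (1 - a) / (1 - 2 a)]. *)
Definition inflation l : R := (1 - l) / (1 - 2 * l).

Lemma inflationE l : 2 * l < 1 -> inflation l = 1 + l / (1 - 2 * l).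
Proof. by move=> l1; rewrite /inflation; field; rewrite subr_eq0 gt_eqF. Qed.

Lemma expR_inflation_le a l : 0 <= a <= l -> 2 * l < 1 ->
  expR (- (2 * inflation l * a)) <= 1 - 2 * a.
Proof.
move=> /andP[a0 al] l1.
have l0 : 0 < 1 - 2 * l by rewrite subr_gt0.
have d0 : 0 < 1 - 2 * a by lra.
pose y := 2 * inflation a * a.
have inf_le : inflation a <= inflation l.
  rewrite !inflationE; [|lra|lra].
  by rewrite lerD2l ler_pM ?invr_ge0 ?(ltW d0)// lef_pV2 ?posrE//; lra.
apply: (@le_trans _ _ (expR (- y))).
  by rewrite ler_expR lerN2 /y ler_wpM2r// ler_wpM2l.
rewrite expRN -[leRHS]invrK lef_pV2 ?posrE ?invr_gt0 ?expR_gt0//.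
have y0 : 0 <= y.
  by rewrite /y /inflation !mulr_ge0 ?invr_ge0 ?(ltW d0)//; lra.
apply: le_trans (expR_ge_quadratic y0).
rewrite -[leLHS]mul1r ler_pdivrMr//.
have -> : (1 + y + y ^+ 2 / 2) * (1 - 2 * a) =
    1 + 2 * a ^+ 4 / (1 - 2 * a).
  by rewrite /y /inflation; field; rewrite gt_eqF.
by rewrite lerDl divr_ge0 ?(ltW d0)// mulr_ge0// exprn_ge0.
Qed.

(** Combines the determinant bound with [1 - 2 a >= exp (- 2 inflation l a)] for
    every eigenvalue [a] of [C]. *)
Lemma qform_mgf_trace n (m : probability (n.-tuple R) R)
    (mu : 'I_n -> probability R R) (C : 'M[R]_n) l :
  product_law m mu -> (forall i, gaussian_dominated (mu i)) -> psd C ->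
  (forall x, qform C x <= l * qform 1%:M x) -> 2 * l < 1 ->
  (\int[m]_t (expR (qform C (colv t)))%:E <=
   (expR (inflation l * \tr C))%:E)%E.
Proof.
move=> mE mug Cpsd Cl l1.
have Cpd (x : 'cV[R]_n) : x != 0 -> 0 < qform (1%:M - 2 *: C) x.
  move=> /qform1_gt0 x0; rewrite qformD -scaleNr qformZ.
  rewrite mulNr subr_gt0 (le_lt_trans (ler_wpM2l _ (Cl x)))//.
  by rewrite mulrA gtr_pMl.
apply: (le_trans (qform_mgf_det mE mug Cpsd Cpd)).
have detC := det_ge_expR_trace Cpsd Cl (fun a al => expR_inflation_le al l1).
rewrite lee_fin -[leRHS]invrK -expRN lef_pV2 ?posrE ?expR_gt0 ?sqrtr_gt0//.
  rewrite -(ler_pXn2r (n := 2)) ?nnegrE ?expR_ge0 ?sqrtr_ge0//.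
  rewrite sqr_sqrtr; last exact: le_trans (expR_ge0 _) detC.
  by rewrite -expRM_natl mulrN mulrA.
exact: lt_le_trans (expR_gt0 _) detC.
Qed.

End trace_mgf.

(** * Families of independent random vectors *)

Section random_tuples.
Context {d dS} {T : measurableType d} {S : measurableType dS} {R : realType}.
Variable P : probability T R.

Definition tuple_of_rv n (Z : 'I_n -> {RV P >-> S}) (t : T) : n.-tuple S :=
  [tuple Z i t | i < n].

Lemma measurable_tuple_of_rv n (Z : 'I_n -> {RV P >-> S}) :
  measurable_fun setT (tuple_of_rv Z).
Proof.
apply/measurable_fun_tnthP => i; rewrite (_ : _ \o _ = Z i)//.
by apply/funext => t /=; rewrite tnth_mktuple.
Qed.

HB.instance Definition _ n (Z : 'I_n -> {RV P >-> S}) :=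
  isMeasurableFun.Build _ _ _ _ (tuple_of_rv Z) (measurable_tuple_of_rv Z).

Lemma preimage_tuple_of_rv n (Z : 'I_n -> {RV P >-> S}) A :
  tuple_of_rv Z @^-1` tuple_rect A = \bigcap_(i in setT) (Z i @^-1` A i).
Proof.
apply/seteqP; split => t /=.
  by move=> ZA i _; have := ZA i; rewrite tnth_mktuple.
by move=> ZA i; rewrite tnth_mktuple; exact: ZA.
Qed.

End random_tuples.

Section independent_entries.
Context {d} {T : measurableType d} {R : realType}.
Variable P : probability T R.

Lemma independent_entries_law n (X : {RV P >-> n.-tuple R}) :
  independent_entries P X ->
  product_law (distribution P X)
    (fun i => distribution (distribution P X) (coord i)).
Proof.
move=> indX A mA.
have := indX [set: 'I_n]%SET (fun i => (fun t => tnth (X t) i) @^-1` A i) _.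
rewrite (_ : \bigcap_(_ in _) _ = X @^-1` tuple_rect A); last first.
  apply/seteqP; split => t /= XA i; last by move=> _; exact: XA.
  by apply: XA; rewrite /= inE.
move=> H; apply: etrans (H _) _ => [i _|].
  by exists (A i) => //; rewrite setTI.
by apply: eq_bigl => i; rewrite inE.
Qed.

End independent_entries.

Section independent_vectors.
Context {d} {T : measurableType d} {R : realType}.
Variable P : probability T R.
Variables (k m n : nat) (x : 'I_k -> {RV P >-> m.-tuple R})
  (y : 'I_k -> {RV P >-> n.-tuple R}).
Hypothesis xy : independent_vectors x y.
Local Open Scope ereal_scope.

Lemma independent_vectors_rect A B :
  (forall i, measurable (A i)) -> (forall i, measurable (B i)) ->
  P (tuple_of_rv x @^-1` tuple_rect A `&` tuple_of_rv y @^-1` tuple_rect B) =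
  (\prod_(i < k) P (x i @^-1` A i)) * (\prod_(i < k) P (y i @^-1` B i)).
Proof.
move=> mA mB.
have := xy (J := [set: 'I_k + 'I_k]%SET) (A := fun i =>
  match i with inl a => x a @^-1` A a | inr b => y b @^-1` B b end) _.
rewrite (_ : \bigcap_(_ in _) _ = tuple_of_rv x @^-1` tuple_rect A `&`
    tuple_of_rv y @^-1` tuple_rect B); last first.
  rewrite !preimage_tuple_of_rv; apply/seteqP; split => t /=.
    by move=> H; split => i _; [apply: (H (inl i))|apply: (H (inr i))];
      rewrite /= inE.
  by move=> [HA HB] [i|i] _; [exact: HA|exact: HB].
move=> H; apply: etrans (H _) _ => [[i|i] _|]; 
  [by exists (A i) => //; rewrite setTI|by exists (B i) => //; rewrite setTI|].
under eq_bigl do rewrite inE.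
by rewrite big_sumType.
Qed.

Lemma independent_vectors_lawl :
  product_law (distribution P (tuple_of_rv x)) (fun i => distribution P (x i)).
Proof.
move=> A mA; have := independent_vectors_rect mA (fun=> measurableT).
rewrite tuple_rectT preimage_setT setIT => H; apply: etrans H _.
under [X in _ * X]eq_bigr do rewrite probability_setT.
by rewrite prode_1 mule1.
Qed.

Lemma independent_vectors_lawr :
  product_law (distribution P (tuple_of_rv y)) (fun i => distribution P (y i)).
Proof.
move=> B mB; have := independent_vectors_rect (fun=> measurableT) mB.
rewrite tuple_rectT preimage_setT setTI => H; apply: etrans H _.
under eq_bigr do rewrite probability_setT.
by rewrite prode_1 mul1e.
Qed.

Lemma independent_vectors_integral
    (f : k.-tuple (m.-tuple R) * k.-tuple (n.-tuple R) -> \bar R) :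
  measurable_fun setT f -> (forall z, 0 <= f z) ->
  \int[P]_t f (tuple_of_rv x t, tuple_of_rv y t) =
  \int[distribution P (tuple_of_rv y)]_v
    \int[distribution P (tuple_of_rv x)]_u f (u, v).
Proof.
move=> mf f0.
apply: (indep_integral (@tuple_rects_generate _ _ _) (@tuple_rects_setI _ _ _)
  (@tuple_rects_generate _ _ _) (@tuple_rects_setI _ _ _)) => //.
move=> _ _ [A mA <-] [B mB <-]; rewrite independent_vectors_rect//.
by rewrite -independent_vectors_lawl// -independent_vectors_lawr.
Qed.

End independent_vectors.

(** * Chernoff's method for the estimator *)

Section chernoff.
Context {d} {T : measurableType d} {R : realType}.
Variable P : probability T R.
Local Open Scope ereal_scope.

Lemma markov_expR (W : T -> R) (E : set T) (a : R) :
  measurable E -> measurable_fun setT W -> (forall t, (0 <= W t)%R) ->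
  (forall t, E t -> (expR a <= W t)%R) ->
  P E <= (expR (- a))%:E * \int[P]_t (W t)%:E.
Proof.
move=> mE mW W0 EW.
rewrite expRN -lee_pdivrMl ?invr_gt0 ?expR_gt0// invrK.
rewrite -integral_cst//; apply: (@le_trans _ _ (\int[P]_(t in E) (W t)%:E)).
  apply: ge0_le_integral => //.
  - by move=> t _; rewrite lee_fin expR_ge0.
  - by apply/measurable_EFinP; exact: measurable_funTS.
apply: ge0_subset_integral => //; first exact/measurable_EFinP.
by move=> t _; rewrite lee_fin.
Qed.

Lemma union_bound k (V : 'I_k -> set T) : (forall i, measurable (V i)) ->
  P (\big[setU/set0]_(i < k) V i) <= \sum_(i < k) P (V i).
Proof.
elim: k V => [|k IH] V mV; first by rewrite !big_ord0 measure0.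
rewrite !big_ord_recl; apply: (le_trans (measureU2 _ _ _)) => //.
  exact: bigsetU_measurable.
by rewrite leeD2l// IH.
Qed.

End chernoff.

Lemma measurable_sublevel d (T : measurableType d) (R : realType) (f : T -> R)
    (a : R) : measurable_fun setT f -> measurable [set t | f t <= a].
Proof.
move=> mf; rewrite (_ : [set t | _] = setT `&` f @^-1` `]-oo, a]).
  exact: mf.
by apply/seteqP; split => t /=; rewrite in_itv //= => -[].
Qed.

(** With [s] the normalized exponent [theta hn |B|], the bound on the
    moment generating function costs a factor [kappa1 = inflation (c s)] in the
    exponent when [hx i] is fixed with squared length at most [c hn], and a
    further factor [kappa2 = inflation h] when [hx i] is integrated out. *)
Section estimator_tail.
Context {d} {T : measurableType d} {R : realType}.
Variable P : probability T R.
Variables (k hn tn : nat) (B : 'M[R]_(tn * hn)).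
Variables (tx : 'I_k -> {RV P >-> tn.-tuple R})
  (hx : 'I_k -> {RV P >-> hn.-tuple R}).
Hypotheses (hk : (1 <= k)%N) (hhn : (1 <= hn)%N) (htnhn : (tn <= hn)%N).
Hypothesis Bpsd : psd B.
Hypothesis txhx : independent_vectors tx hx.
Hypothesis tx_entries : forall i, independent_entries P (tx i).
Hypothesis hx_entries : forall i, independent_entries P (hx i).
Hypothesis tx_dominated : forall i j,
  gaussian_dominated (distribution (distribution P (tx i)) (coord j)).
Hypothesis hx_dominated : forall i j,
  gaussian_dominated (distribution (distribution P (hx i)) (coord j)).

Variables c s : R.
Hypotheses (c0 : 0 <= c) (s0 : 0 < s).

Local Notation Bnorm := (spectral_norm B).
Hypothesis Bnorm_gt0 : 0 < Bnorm.

Local Notation kappa1 := (inflation (c * s)).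
Local Notation h := (kappa1 * s).
Local Notation kappa2 := (inflation h).
Hypotheses (cs1 : 2 * (c * s) < 1) (h1 : 2 * h < 1).

Let theta := s / (hn%:R * Bnorm).

Let hn_gt0 : 0 < hn%:R :> R. Proof. by rewrite ltr0n. Qed.

Let theta_gt0 : 0 < theta.
Proof. by rewrite divr_gt0// mulr_gt0. Qed.

Let theta_norm : theta * Bnorm * hn%:R = s.
Proof. by rewrite /theta; field; rewrite !gt_eqF. Qed.

Let kappa1_ge0 : 0 <= kappa1.
Proof.
rewrite inflationE// addr_ge0// divr_ge0 ?subr_ge0 ?(ltW cs1)//.
by rewrite mulr_ge0// ltW.
Qed.

(** The vectors for which the conditional moment generating function is
    controlled: the norm of [slice B y] grows with the length of [y]. *)
Definition short : set (hn.-tuple R) :=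
  [set y | qform 1%:M (colv y) <= c * hn%:R].

Lemma measurable_short : measurable short.
Proof. exact: (measurable_sublevel _ (measurable_qform_colv _)). Qed.

Lemma mgf_given_short i y : short y ->
  (\int[distribution P (tx i)]_x (expR (theta * qform B (colv x *t colv y)))%:E
   <= (expR (kappa1 * (theta * qform (partial_trace B) (colv y))))%:E)%E.
Proof.
move=> yU.
under eq_integral do rewrite -qform_slice -qformZ.
rewrite -tr_slice -mxtraceZ; apply: qform_mgf_trace.
- exact: independent_entries_law.
- exact: tx_dominated.
- by apply: psdZ (psd_slice _ Bpsd); exact: ltW.
- move=> x; rewrite qformZ.
  apply: (le_trans (ler_wpM2l (ltW theta_gt0) (qform_slice_le _ _ _))).
  have -> : c * s = theta * Bnorm * (c * hn%:R).
    by rewrite -[in LHS]theta_norm; ring.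
  rewrite (mulrA theta) (mulrA theta) ler_wpM2r ?qform1_ge0//.
  by rewrite ler_wpM2l// mulr_ge0 ?ltW.
- exact: cs1.
Qed.

Lemma mgf_partial_trace i :
  (\int[distribution P (hx i)]_y
     (expR (kappa1 * (theta * qform (partial_trace B) (colv y))))%:E
   <= (expR (kappa2 * (kappa1 * theta * \tr B)))%:E)%E.
Proof.
have kt0 : 0 <= kappa1 * theta by rewrite mulr_ge0// ltW.
under eq_integral do rewrite mulrA -qformZ.
rewrite -(tr_partial_trace B) -mxtraceZ; apply: qform_mgf_trace.
- exact: independent_entries_law.
- exact: hx_dominated.
- exact: psdZ (psd_partial_trace Bpsd).
- move=> y; rewrite qformZ.
  apply: (le_trans (ler_wpM2l kt0 (qform_partial_trace_le _ _))).
  have -> : h = kappa1 * theta * (hn%:R * Bnorm).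
    transitivity (kappa1 * (theta * Bnorm * hn%:R)); last by ring.
    by rewrite theta_norm.
  rewrite [leLHS]mulrA ler_wpM2r ?qform1_ge0// ler_wpM2l//.
  by rewrite ler_wpM2r ?(ltW Bnorm_gt0)// ler_nat.
- exact: h1.
Qed.

Let phi (x : tn.-tuple R) (y : hn.-tuple R) : R :=
  \1_short y * expR (theta * qform B (colv x *t colv y)).

Let phi_ge0 x y : 0 <= phi x y.
Proof. by rewrite mulr_ge0 ?expR_ge0. Qed.

Let measurable_tens d' (T' : measurableType d') (u : T' -> tn.-tuple R)
    (v : T' -> hn.-tuple R) :
  measurable_fun setT u -> measurable_fun setT v ->
  measurable_fun setT (fun t => qform B (colv (u t) *t colv (v t))).
Proof.
move=> mu mv; apply: measurable_qform => i.
under eq_fun do rewrite mxE !mxE.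
by apply: measurable_funM; apply: (measurableT_comp (measurable_tnth _)).
Qed.

Let measurable_phi d' (T' : measurableType d') (u : T' -> tn.-tuple R)
    (v : T' -> hn.-tuple R) :
  measurable_fun setT u -> measurable_fun setT v ->
  measurable_fun setT (fun t => phi (u t) (v t)).
Proof.
move=> mu mv; apply: measurable_funM.
  by apply: measurableT_comp => //; apply: measurable_indic;
    exact: measurable_short.
apply: measurableT_comp => //; apply: measurable_funM => //.
exact: measurable_tens.
Qed.

(** The factor [phi] vanishes when [hx i] is not short, which truncates the
    moment generating function where it may be infinite.  Given all the
    [hx i], the product over [i] factors; so does the product of the resulting
    bounds. *)
Lemma mgf_est :
  (\int[P]_t (\prod_(i < k) phi (tx i t) (hx i t))%:E <=
   (expR (k%:R * (kappa2 * (kappa1 * theta * \tr B))))%:E)%E.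
Proof.
pose f (z : k.-tuple (tn.-tuple R) * k.-tuple (hn.-tuple R)) : \bar R :=
  (\prod_(i < k) phi (tnth z.1 i) (tnth z.2 i))%:E.
have f0 z : (0 <= f z)%E by rewrite lee_fin prodr_ge0.
have mf : measurable_fun setT f.
  apply/measurable_EFinP; apply: measurable_prod => i _; apply: measurable_phi.
    exact: (measurableT_comp (measurable_tnth i) measurable_fst).
  exact: (measurableT_comp (measurable_tnth i) measurable_snd).
have -> : (\int[P]_t (\prod_(i < k) phi (tx i t) (hx i t))%:E =
    \int[P]_t f (tuple_of_rv tx t, tuple_of_rv hx t))%E.
  apply: eq_integral => t _; congr (_%:E); apply: eq_bigr => i _ /=.
  by rewrite !tnth_mktuple.
rewrite (independent_vectors_integral txhx mf f0).
apply: (@le_trans _ _ (\int[distribution P (tuple_of_rv hx)]_v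
   (\prod_(i < k)
     expR (kappa1 * (theta *
       qform (partial_trace B) (colv (tnth v i)))))%:E)%E).
  apply: ge0_le_integral => //.
  - by move=> v _; apply: integral_ge0.
  - exact: (measurable_fun_fubini_tonelli_G
      (m1 := distribution P (tuple_of_rv tx)) f mf f0).
  - apply/measurable_EFinP; apply: measurable_prod => i _.
    apply: measurableT_comp => //; do 2 apply: measurable_funM => //.
    exact: (measurableT_comp (measurable_qform_colv _) (measurable_tnth i)).
  - move=> v _; rewrite /f /=.
    apply: (product_law_prod (f := fun i x => phi x (tnth v i))
      (c := fun i => expR (kappa1 * (theta *
         qform (partial_trace B) (colv (tnth v i)))))
      (independent_vectors_lawl txhx)) => [i|i x|i|i].
    + exact: measurable_phi.
    + exact: phi_ge0.
    + exact: expR_ge0.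
    + rewrite /phi indicE; case: (boolP (tnth v i \in short)) => [|_].
        by rewrite inE => vU; under eq_integral do rewrite mul1r;
          exact: mgf_given_short.
      by under eq_integral do rewrite mul0r; rewrite integral0 lee_fin expR_ge0.
rewrite expRM_natl -[X in _ ^+ X]card_ord -prodr_const.
apply: (product_law_prod (f := fun i y =>
    expR (kappa1 * (theta * qform (partial_trace B) (colv y))))
  (independent_vectors_lawr txhx)) => [i|i x|i|i].
- apply: measurableT_comp => //; do 2 apply: measurable_funM => //.
  exact: measurable_qform_colv.
- exact: expR_ge0.
- exact: expR_ge0.
- exact: mgf_partial_trace.
Qed.

Variables eps delta : R.
Hypothesis eps0 : 0 < eps.
Hypothesis long_delta : forall i, (P [set t | ~ short (hx i t)] <= delta%:E)%E.

Let good : set T := [set t | \tr B >= 1 / (1 + eps) * Est B tx hx t].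

Let measurable_Est : measurable_fun setT (Est B tx hx).
Proof.
apply: measurable_funM => //; apply: measurable_sum => i.
exact: measurable_tens.
Qed.

Let measurable_good : measurable good.
Proof. by apply: measurable_sublevel; exact: measurable_funM. Qed.

Let measurable_hx_short i : measurable [set t | short (hx i t)].
Proof. exact: (mfun_measurable_preimage (hx i) measurable_short). Qed.

(** The bad event is split according to whether all the [hx i] are short:
    Markov's inequality for the truncated product in one case, a union bound in
    the other. *)
Lemma est_tail :
  ((1 - expR (k%:R * (\tr B / Bnorm) / hn%:R * (kappa2 * h - (1 + eps) * s))
      - k%:R * delta)%:E <= P good)%E.
Proof.
pose V := \big[setU/set0]_(i < k) [set t | ~ short (hx i t)].
pose E := ~` good `&` \bigcap_(i in setT) [set t | short (hx i t)].
have mlong i : measurable [set t | ~ short (hx i t)].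
  exact: (measurableC (measurable_hx_short i)).
have mE : measurable E.
  apply: measurableI; first exact: measurableC.
  exact: fin_bigcap_measurable.
have PV : (P V <= (k%:R * delta)%:E)%E.
  apply: (le_trans (union_bound P mlong)).
  apply: (@le_trans _ _ (\sum_(i < k) delta%:E)%E).
    by apply: lee_sum => i _; exact: long_delta.
  by rewrite sumEFin sumr_const card_ord mulr_natl.
pose W t := \prod_(i < k) phi (tx i t) (hx i t).
have mW : measurable_fun setT W.
  by apply: measurable_prod => i _; exact: measurable_phi.
have EW t : E t -> expR (theta * (k%:R * ((1 + eps) * \tr B))) <= W t.
  move=> [/negP bad st].
  have -> : W t =
      expR (theta * \sum_(i < k) qform B (colv (tx i t) *t colv (hx i t))).
    rewrite mulr_sumr expR_sum; apply: eq_bigr => i _.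
    by rewrite /phi indicE mem_set ?mul1r//; exact: st.
  rewrite ler_expR ler_wpM2l ?(ltW theta_gt0)//.
  move: bad; rewrite -ltNge /Est mulrA => /ltW.
  rewrite mul1r -invfM ler_pdivlMl ?mulr_gt0 ?ltr0n ?addr_gt0//.
  move=> H; apply: le_trans H; rewrite le_eqVlt.
  by apply/orP; left; apply/eqP; ring.
have PE : (P E <=
    (expR (k%:R * (\tr B / Bnorm) / hn%:R *
       (kappa2 * h - (1 + eps) * s)))%:E)%E.
  apply: (le_trans (markov_expR P mE mW _ EW)).
    by move=> t; exact: prodr_ge0.
  apply: (le_trans (lee_wpmul2l _ mgf_est)); first by rewrite lee_fin expR_ge0.
  rewrite -EFinM -expRD lee_fin ler_expR le_eqVlt; apply/orP; left; apply/eqP.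
  by rewrite /theta; field; rewrite !gt_eqF.
have : (P (~` good) <= P E + P V)%E.
  apply: (@le_trans _ _ (P (E `|` V))); last first.
    by apply: measureU2 => //; exact: bigsetU_measurable.
  apply: le_measure; rewrite ?inE//.
  - exact: measurableC.
  - by apply: measurableU => //; exact: bigsetU_measurable.
  - move=> t bad; have [st|] := pselect (forall i, short (hx i t)).
      by left; split => // i _; exact: st.
    move=> /existsNP[i lt]; right.
    by rewrite /V (bigD1 i)//=; left.
move=> /le_trans/(_ (leeD PE PV)).
rewrite probability_setC//.
rewrite leeBlDr ?fin_num_measure// -leeBlDl//.
by rewrite -!EFinD opprD addrA.
Qed.

End estimator_tail.

(** * Numerical constants *)

Section constants.
Context {R : realType}.

(** The left-hand side is [s + (c + 1) s^2] up to terms of order [s^3], which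
    the larger coefficient absorbs. *)
Lemma inflation_twice_le (c s : R) : 0 <= s -> 0 <= c -> c * s <= 1 / 4 ->
  s <= 1 / 8 ->
  [/\ 2 * (c * s) < 1, 2 * (inflation (c * s) * s) < 1 &
      inflation (inflation (c * s) * s) * (inflation (c * s) * s) <=
      s + (2 * c + 18 / 5) * s ^+ 2].
Proof.
move=> s0 c0 cs s8.
have cs0 : 0 <= c * s by rewrite mulr_ge0.
have k1 : 1 <= inflation (c * s) <= 1 + 2 * (c * s).
  rewrite inflationE; last by lra.
  rewrite lerDl divr_ge0//=; last by lra.
  rewrite lerD2l ler_pdivrMr; last by lra.
  by rewrite -mulrA mulrCA ler_peMr//; lra.
move: (inflation (c * s)) k1 => k /andP[k1 k2].
have h0 : 0 <= k * s by rewrite mulr_ge0//; lra.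
have h1 : k * s <= s + 2 * c * s ^+ 2.
  by apply: (le_trans (ler_wpM2r s0 k2)); lra.
have h2 : k * s <= 3 / 2 * s by rewrite ler_wpM2r//; lra.
split; [lra|lra|].
have h3 : (k * s) ^+ 2 / (1 - 2 * (k * s)) <= 18 / 5 * s ^+ 2.
  rewrite ler_pdivrMr; last by lra.
  apply: (@le_trans _ _ (9 / 4 * s ^+ 2)).
    have -> : 9 / 4 * s ^+ 2 = (3 / 2 * s) ^+ 2 by field.
    by rewrite ler_pXn2r ?nnegrE//; lra.
  have -> : 18 / 5 * s ^+ 2 * (1 - 2 * (k * s)) =
    18 / 5 * (1 - 2 * (k * s)) * s ^+ 2 by ring.
  by rewrite ler_wpM2r ?sqr_ge0//; lra.
rewrite inflationE; last by lra.
rewrite mulrDl mul1r mulrAC -expr2; lra.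
Qed.

(** The Taylor polynomial of degree 5 gives [e >= 163 / 60], whose cube exceeds
    20 by less than 0.05. *)
Lemma expR3_ge20 : 20 <= expR 3 :> R.
Proof.
have e1 : 163 / 60 <= expR 1 :> R.
  apply: le_trans (expR_ge_taylor 6 ler01).
  rewrite !big_nat_recr ?big_geq//= !expr1n !mul1r.
  have [-> -> -> ->] : [/\ 2`! = 2, 3`! = 6, 4`! = 24 & 5`! = 120]%N by [].
  by rewrite fact0; lra.
have e2 : 59 / 8 <= expR 1 ^+ 2 :> R.
  apply: (@le_trans _ _ ((163 / 60) ^+ 2)); first by lra.
  by rewrite ler_pXn2r ?nnegrE ?expR_ge0//; lra.
have -> : 3 = 3%:R * 1 :> R by rewrite mulr1.
rewrite expRM_natl exprSr.
apply: (@le_trans _ _ (59 / 8 * (163 / 60))); first by lra.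
by apply: ler_pM => //; lra.
Qed.

(** The squares of the [n]-th roots of the two sides are [4 exp (- 3)] and
    [1 / 5]. *)
Lemma gaussian_tail_constant n :
  expR (- (3 / 8 * (4 * n%:R))) * 2 ^+ n <= 1 / 5 `^ (n%:R / 2) :> R.
Proof.
have -> : 3 / 8 * (4 * n%:R) = n%:R * (3 / 2) :> R by field.
rewrite mulrC [n%:R * _]mulrC -mulNr expRM_natr -exprMn.
have -> : 5 `^ (n%:R / 2) = Num.sqrt 5 ^+ n :> R.
  by rewrite mulrC powRrM powR_mulrn ?powR_ge0// powR12_sqrt.
rewrite mul1r -exprVn.
apply: lerXn2r; rewrite ?nnegrE ?mulr_ge0 ?expR_ge0 ?invr_ge0 ?sqrtr_ge0//.
rewrite -(ler_pXn2r (n := 2)) ?nnegrE ?mulr_ge0 ?expR_ge0 ?invr_ge0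
  ?sqrtr_ge0//.
rewrite exprVn sqr_sqrtr// exprMn -expRM_natl.
have -> : 2 * - (3 / 2) = - 3 :> R by field.
rewrite expRN ler_pdivrMr ?expR_gt0//.
have := expR3_ge20; lra.
Qed.

End constants.

(** * Lengths of Gaussian and Rademacher vectors *)

Section norm_tails.
Context {d} {T : measurableType d} {R : realType}.
Variable P : probability T R.
Variables (n : nat) (X : {RV P >-> n.-tuple R}).

Lemma std_gaussian_dominated j : std_gaussian X ->
  gaussian_dominated (distribution (distribution P X) (coord j)).
Proof.
move=> [_ XN]; apply: normal_gaussian_dominated => A mA; exact: XN.
Qed.

Lemma rademacher_dominated j : rademacher X ->
  gaussian_dominated (distribution (distribution P X) (coord j)).
Proof.
by move=> [_ XR]; apply: rademacher_gaussian_dominated; have [] := XR j.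
Qed.

(** Markov's inequality for [exp (3 / 8 |X|^2)], whose expectation is [2 ^ n];
    [3 / 8] is the optimal exponent for the threshold [4 n]. *)
Lemma std_gaussian_norm_tail : std_gaussian X ->
  (P [set t | ~ short 4 (X t)] <= (1 / 5 `^ (n%:R / 2))%:E)%E.
Proof.
move=> XN.
pose C : 'M[R]_n := (3 / 8)%:M.
have CE : C = (3 / 8) *: 1%:M by rewrite scalemx1.
have qC x : qform C x = 3 / 8 * qform 1%:M x by rewrite CE qformZ.
have DE : 1%:M - 2 *: C = (1 / 4)%:M.
  by rewrite /C scale_scalar_mx -raddfB /=; congr (_%:M); field.
have mgf : (\int[distribution P X]_y (expR (qform C (colv y)))%:E <=
    (2 ^+ n)%:E)%E.
  apply: (le_trans (qform_mgf_det (independent_entries_law (proj1 XN)) _ _ _)).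
  - by move=> j; exact: std_gaussian_dominated.
  - split=> [|x]; first by rewrite tr_scalar_mx.
    by rewrite qC mulr_ge0 ?qform1_ge0.
  - by move=> x x0; rewrite DE -scalemx1 qformZ mulr_gt0 ?qform1_gt0.
  rewrite DE det_scalar (_ : 1 / 4 = (2^-1) ^+ 2); last by field.
  by rewrite -exprM mulnC exprM sqrtr_sqr ger0_norm ?exprn_ge0// exprVn invrK.
have mlong : measurable (~` short (hn := n) 4 : set (n.-tuple R)).
  by apply: measurableC; exact: measurable_short.
have long y : (~` short (hn := n) 4) y ->
    expR (3 / 8 * (4 * n%:R)) <= expR (qform C (colv y)).
  by move=> /negP; rewrite -ltNge qC ler_expR => /ltW ?; rewrite ler_wpM2l.
have mW : measurable_fun setT (fun y : n.-tuple R => expR (qform C (colv y))).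
  by apply: measurableT_comp => //; exact: measurable_qform_colv.
apply: (le_trans
  (markov_expR (distribution P X) mlong mW (fun=> expR_ge0 _) long)).
apply: (le_trans (lee_wpmul2l _ mgf)); first by rewrite lee_fin expR_ge0.
by rewrite -EFinM lee_fin; exact: gaussian_tail_constant.
Qed.

(** Almost surely every entry is [1] or [-1], so that [|X|^2 = n]. *)
Lemma rademacher_norm_tail : rademacher X ->
  (P [set t | ~ short 1 (X t)] <= 0%:E)%E.
Proof.
move=> [_ XR].
have mX j (r : R) : measurable [set t | tnth (X t) j = r].
  exact: (mfun_measurable_preimage X (mfun_measurable_preimage (coord j)
    (measurable_set1 r))).
pose V j : set T :=
  ~` ([set t | tnth (X t) j = 1] `|` [set t | tnth (X t) j = -1]).
have mV j : measurable (V j) by apply: measurableC; exact: measurableU.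
have PV j : P (V j) = 0%E.
  rewrite /V probability_setC; last exact: measurableU.
  have [P1 PN1] := XR j.
  have -> : P ([set t | tnth (X t) j = 1%R] `|` [set t | tnth (X t) j = (-1)%R])
      = (2^-1%:E + 2^-1%:E)%E.
    rewrite -[X in (X + _)%E]P1 -PN1; apply: measureU => //.
    apply/seteqP; split => // t /= [-> /eqP]; rewrite -subr_eq0 opprK.
    by rewrite paddr_eq0 ?ler01// oner_eq0.
  by rewrite -EFinD; congr (_%:E); field.
apply: (@le_trans _ _ (P (\big[setU/set0]_(j < n) V j))); last first.
  apply: (le_trans (union_bound P mV)).
  by rewrite big1// => j _; exact: PV.
apply: le_measure; rewrite ?inE.
- apply: (measurableC (mfun_measurable_preimage X (@measurable_short _ _ _))).
- exact: bigsetU_measurable.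
- move=> t; apply: contra_notP => tV.
  rewrite /short /= mul1r qform1.
  rewrite (eq_bigr (fun=> 1)) ?sumr_const ?card_ord// => j _.
  rewrite mxE.
  have : ~ V j t by move=> Vj; apply: tV; rewrite (bigD1 j)//=; left.
  by move=> /contrapT[->|->]; rewrite ?sqrrN expr1n.
Qed.

End norm_tails.

(** * The tail bound *)

(** With [s = eps / r] the exponent of [est_tail] is at most [k rho / hn] times
    [(2 c + 18 / 5) s^2 - r s^2], which is at most [- r s^2 / 2]. *)
Lemma est_tail_rate {d} {T : measurableType d} {R : realType}
    (P : probability T R) (k hn tn : nat) (B : 'M[R]_(tn * hn))
    (tx : 'I_k -> {RV P >-> tn.-tuple R}) (hx : 'I_k -> {RV P >-> hn.-tuple R})
    (c r eps delta : R) :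
  (1 <= k)%N -> (1 <= hn)%N -> (tn <= hn)%N -> psd B ->
  independent_vectors tx hx ->
  (forall i, independent_entries P (tx i)) ->
  (forall i, independent_entries P (hx i)) ->
  (forall i j,
     gaussian_dominated (distribution (distribution P (tx i)) (coord j))) ->
  (forall i j,
     gaussian_dominated (distribution (distribution P (hx i)) (coord j))) ->
  0 <= c -> 0 < r -> 0 < eps -> c * (eps / r) <= 1 / 4 -> eps / r <= 1 / 8 ->
  2 * c + 18 / 5 <= r / 2 -> 0 <= delta ->
  (forall i, (P [set t | ~ short c (hx i t)] <= delta%:E)%E) ->
  ((1 - expR (- (k%:R * (\tr B / spectral_norm B) * eps ^+ 2 /
        (2 * r * hn%:R))) - k%:R * delta)%:E
    <= P [set t | \tr B >= 1 / (1 + eps) * Est B tx hx t]%R)%E.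
Proof.
move=> hk hhn htnhn Bpsd txhx txI hxI txD hxD c0 r0 eps0 cs s8 cr delta0 long.
have trB0 := psd_trace_ge0 Bpsd.
have [N0|N0] := eqVneq (spectral_norm B) 0.
  (* division by zero makes the probability bound nonpositive *)
  rewrite N0 invr0 !mulr0 !mul0r oppr0 expR0 subrr sub0r.
  by apply: (@le_trans _ _ 0%E) => //; rewrite lee_fin oppr_le0 mulr_ge0.
have {}N0 : 0 < spectral_norm B.
  by rewrite lt_neqAle eq_sym N0 spectral_norm_ge0.
pose s := eps / r.
have s0 : 0 < s by rewrite divr_gt0.
have [cs1 h1 hs] := inflation_twice_le (ltW s0) c0 cs s8.
apply: le_trans (est_tail hk hhn htnhn Bpsd txhx txI hxI txD hxD c0 s0 N0 cs1 h1
  eps0 long).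
rewrite lee_fin lerD2r lerD2l lerN2 ler_expR.
have -> : - (k%:R * (\tr B / spectral_norm B) * eps ^+ 2 / (2 * r * hn%:R)) =
    k%:R * (\tr B / spectral_norm B) / hn%:R * - (eps ^+ 2 / (2 * r)).
  by field; rewrite !gt_eqF// ltr0n.
rewrite ler_wpM2l//.
  by apply: divr_ge0 => //; apply: mulr_ge0 => //; apply: divr_ge0 (ltW N0).
have epsE : eps = r * s by rewrite /s mulrCA mulfV ?mulr1// gt_eqF.
have -> : eps ^+ 2 / (2 * r) = r / 2 * s ^+ 2.
  by rewrite epsE; field; rewrite gt_eqF.
have cr2 : (2 * c + 18 / 5) * s ^+ 2 <= r / 2 * s ^+ 2.
  by rewrite ler_wpM2r ?sqr_ge0.
have -> : (1 + eps) * s = s + r * s ^+ 2 by rewrite epsE; ring.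
lra.
Qed.

Theorem theorem3p4 (R : realType) (d : measure_display) (T : measurableType d)
    (P : probability T R) (k hn tn : nat)
    (hk : (1 <= k)%N) (hhn : (1 <= hn)%N) (htn : (1 <= tn)%N)
    (htnhn : (tn <= hn)%N)
    (B : 'M[R]_(tn * hn)) (Bpsd : psd B) (Bneq0 : B != 0)
    (tx : 'I_k -> {RV P >-> tn.-tuple R})
    (hx : 'I_k -> {RV P >-> hn.-tuple R})
    (eps : R) :
  let rho := \tr B / spectral_norm B in
  (independent_vectors tx hx ->
   (forall i, std_gaussian (tx i)) -> (forall i, std_gaussian (hx i)) ->
   0 < eps < 25 / 16 ->
   ((1 - expR (- (k%:R * rho * eps ^+ 2 / (50 * hn%:R)))
       - k%:R * (1 / 5 `^ (hn%:R / 2)))%:E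
    <= P [set t | \tr B >= 1 / (1 + eps) * Est B tx hx t]%R)%E)
  /\
  (independent_vectors tx hx ->
   (forall i, rademacher (tx i)) -> (forall i, rademacher (hx i)) ->
   0 < eps < 13 / 4 ->
   ((1 - expR (- (k%:R * rho * eps ^+ 2 / (52 * hn%:R))))%:E
    <= P [set t | \tr B >= 1 / (1 + eps) * Est B tx hx t]%R)%E).
Proof.
move=> rho; split=> txhx txL hxL /andP[eps0 eps1].
  have := @est_tail_rate _ _ _ P k hn tn B tx hx 4 25 eps
    (1 / 5 `^ (hn%:R / 2)) hk hhn htnhn Bpsd txhx.
  rewrite (_ : 2 * 25 = 50 :> R); last by field.
  apply; try lra.
  - by move=> i; case: (txL i).
  - by move=> i; case: (hxL i).
  - by move=> i j; exact: std_gaussian_dominated.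
  - by move=> i j; exact: std_gaussian_dominated.
  - by rewrite divr_ge0 ?powR_ge0.
  - by move=> i; exact: std_gaussian_norm_tail.
have := @est_tail_rate _ _ _ P k hn tn B tx hx 1 26 eps 0
  hk hhn htnhn Bpsd txhx.
rewrite (_ : 2 * 26 = 52 :> R); last by field.
rewrite mulr0 subr0.
apply; try lra.
- by move=> i; case: (txL i).
- by move=> i; case: (hxL i).
- by move=> i j; exact: rademacher_dominated.
- by move=> i j; exact: rademacher_dominated.
- by move=> i; exact: rademacher_norm_tail.
Qed.
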